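(* Let $n\ge 2$. There exists a constant $C_n>0$ depending only on $n$, satisfying $|v_2(x_1,x')|\le C_n\,\underline a(x_1)$ for all $(x_1,x')\in[0,1]\times\overline{B}_1^{n-1}$ (with $v_2$ and $\underline a$ as defined in the context), such that the following holds. Let $\Omega\subset\mathbb{R}^n$ be open, bounded and convex, let $L:\mathbb{R}^n\to\mathbb{R}^n$ be an affine bijection with $L\Omega\subset B_1^n$, let $\Lambda\ge 0$, and let $u\in C(\overline\Omega)$ be a convex function with Monge--Ampère measure $\mu_u\le\Lambda\,dx$ in $\Omega$ and $u|_{\partial\Omega}=0$. Then for all $x\in\Omega$ $$|u(x)|\le C_n\,|\det L|^{-2/n}\,\Lambda^{1/n}\;\underline a\big(|L|\operatorname{dist}(x,\partial\Omega)\big).$$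
   Context: $B_R^k\subset\mathbb{R}^k$ is the open ball of radius $R$ around the origin; $|\cdot|$ is the absolute value of a number, the Euclidean norm of a vector, and the Lebesgue measure of a set. For an affine bijection $L$, $|L|$ and $\det L$ denote the spectral norm and the determinant of its linear part. A point $x\in\mathbb{R}^n$ is written $(x_1,x')$ with $x'=(x_2,\dots,x_n)$. For a convex function $u$ on $\Omega$, $\partial u(x)=\{\xi\in\mathbb{R}^n: u(y)\ge u(x)+\langle\xi,y-x\rangle\ \forall y\in\Omega\}$ and the Monge--Ampère measure is $\mu_u(A)=\big|\bigcup_{x\in A}\partial u(x)\big|$ for Borel $A\subset\Omega$. $dx$ is Lebesgue measure. The function $\underline a$: for $n=2$, $\underline a(t)=t(1-\ln t)$ for $t>0$ and $\underline a(0)=0$; for $n\ge3$, $\underline a(t)=t^{2/n}$. $v_2\in C(\overline K)$ is the convex solution of $\mu_{v_2}=1\,dx$ in $K:=(0,2)\times B_1^{n-1}$, $v_2=0$ on $\partial K$. *)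

(* Defs.v *)
From HB Require Import structures.
From mathcomp Require Import all_boot all_order all_algebra.
From mathcomp Require Import all_classical all_reals all_analysis.

Set Implicit Arguments.
Unset Strict Implicit.
Unset Printing Implicit Defensive.

Import Order.TTheory GRing.Theory Num.Theory.
Import numFieldNormedType.Exports.

Local Open Scope classical_set_scope.
Local Open Scope ring_scope.

(* Points of R^n are row vectors. Their canonical norm in the library is the
   sup norm; it is only used through the topology it induces (open, closure,
   bounded_set, continuity). The Euclidean norm is [enorm]. *)

Section euclidean.
Context {R : realType} {n : nat}.
Implicit Types (x y : 'rV[R]_n) (A : set 'rV[R]_n).

Definition dot x y : R := \sum_i x 0 i * y 0 i.

Definition enorm x : R := Num.sqrt (\sum_i x 0 i ^+ 2).

Definition eball (r : R) : set 'rV[R]_n := [set x | enorm x < r].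

Definition boundary A : set 'rV[R]_n := closure A `\` A°.

Definition dist_set x A : R := inf [set enorm (x - y) | y in A].

(* Linear maps act on row vectors by right multiplication; the linear part of
   [affine_map M b] is [M]. *)
Definition affine_map (M : 'M[R]_n) (b : 'rV[R]_n) x : 'rV[R]_n := x *m M + b.

Definition spectral_norm (M : 'M[R]_n) : R :=
  sup [set enorm (x *m M) | x in [set x | enorm x <= 1]].

End euclidean.

Section monge_ampere.
Context {R : realType} {n : nat}.
Implicit Types (Omega A : set 'rV[R]_n) (u : 'rV[R]_n -> R).

(* n-dimensional Lebesgue measure as the outer measure given by countable
   covers by closed boxes. It is defined on every set, so it can be applied to
   unions of subdifferentials, which are Lebesgue measurable but need not be
   Borel a priori. *)
Definition lebesgue_rV A : \bar R := ereal_inf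
  [set v | exists a b : nat -> 'rV[R]_n,
    [/\ forall k i, a k 0 i <= b k 0 i,
        A `<=` \bigcup_k [set x | forall i, a k 0 i <= x 0 i <= b k 0 i] &
        v = (\sum_(0 <= k <oo) (\prod_i (b k 0 i - a k 0 i))%:E)%E]].

Definition borel_rV : set (set 'rV[R]_n) := <<s open >>.

Definition subdiff Omega u (x : 'rV[R]_n) : set 'rV[R]_n :=
  [set xi | forall y, Omega y -> u x + dot xi (y - x) <= u y].

Definition monge_ampere Omega u A : \bar R :=
  lebesgue_rV (\bigcup_(x in A) subdiff Omega u x).

End monge_ampere.

Section cylinder_problem.
Context {R : realType} {n : nat} (n2 : (2 <= n)%N).
Implicit Types (x : 'rV[R]_n) (v : 'rV[R]_n -> R).

(* x = (x_1, x'), with x_1 the coordinate of index 0. *)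
Definition fst_coord x : R := x 0 (Ordinal (ltnW n2)).

Definition tail_coords x : 'rV[R]_n.-1 := col' (Ordinal (ltnW n2)) x.

Definition cylinder : set 'rV[R]_n :=
  [set x | 0 < fst_coord x < 2 /\ eball 1 (tail_coords x)].

Definition is_cylinder_solution v : Prop :=
  [/\ {within closure cylinder, continuous v},
      convex_function cylinder v,
      forall A, borel_rV A -> A `<=` cylinder ->
        monge_ampere cylinder v A = lebesgue_rV A &
      forall x, boundary cylinder x -> v x = 0].

End cylinder_problem.

(* Only used at t >= 0. *)
Definition a_under {R : realType} (n : nat) (t : R) : R :=
  if n == 2%N then (if 0 < t then t * (1 - ln t) else 0)
  else t `^ (2 / n%:R).

(* Main.v *)
(* The bound is a comparison with an explicit barrier.  In coordinates y = xN + c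
   in which Omega lies in {m <= y_j <= 12n, |y_i| <= 1 for i <> j}, the function
   W(y) = h(y_j) + f(y_j) |y'|^2, with f = t^(2/n), h = - B t^(2/n) for n >= 3 and
   f = t, h = A t ln t - B t for n = 2, is nonpositive and lies above its tangent
   planes by at least (f(t)/4) ((z_j/t)^2 + |z'|^2), t = y_j.  Because
   f(t)^n = t^2, the determinant of this quadratic form does not depend on the
   point.  If u - kW had a negative minimum, it would be attained at an interior
   point, where u is touched from below by a paraboloid of large determinant.
   Every slope in a small box around the touching slope is then a subgradient of
   u at some point of a small parallelepiped, and comparing the two volumes
   contradicts the upper bound on the Monge-Ampere measure.  No change of
   variables beyond linear maps is needed, since the paraboloid is compared with u
   directly.

   The coordinates come from the affine map M and from a linear functional that
   separates Omega from the reflection 2z - x of x at a boundary point z with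
   |x - z| < 2 dist(x, boundary).  After the shift by 5nm, y_j(x) = 5nm is
   comparable to m = |M| dist(x, boundary). *)

Require Import Defs.
From HB Require Import structures.
From mathcomp Require Import all_boot all_order all_algebra.
From mathcomp Require Import all_classical all_reals all_analysis.
From mathcomp Require Import measurable_realfun ring lra.

Set Implicit Arguments.
Unset Strict Implicit.
Unset Printing Implicit Defensive.

Import Order.TTheory GRing.Theory Num.Theory.
Import numFieldNormedType.Exports.

Local Open Scope classical_set_scope.
Local Open Scope ring_scope.

(** * The outer measure of boxes and of linear images *)

Section cover_integral.
Context {R : realType}.

(** Integrating the pointwise bound over [[s, t]] gives the claim: sum and integral commute for
    nonnegative terms, and each indicator integrates to at most [b k - a k]. *)
Lemma weighted_cover_itv (c a b : nat -> R) (C s t : R) :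
  (forall k, 0 <= c k) -> (forall k, a k <= b k) -> 0 <= C -> s <= t ->
  (forall x, s <= x <= t ->
    (C%:E <= \sum_(0 <= k <oo) (c k * (a k <= x <= b k)%R%:R)%:E)%E) ->
  ((C * (t - s))%:E <= \sum_(0 <= k <oo) (c k * (b k - a k))%:E)%E.
Proof.
move=> c0 ab C0 st cov.
have mI (p q : R) : measurable `[p, q] by exact: measurable_itv.
have leI (p q : R) : p <= q -> lebesgue_measure `[p, q]%classic = (q - p)%:E.
  move=> pq; rewrite lebesgue_measure_itv/= lte_fin -EFinB.
  by case: ltgtP pq => // <- _; rewrite subrr.
have fE k x : (c k * (a k <= x <= b k)%R%:R)%:E =
    ((c k)%:E * (\1_(`[a k, b k]) x)%:E)%E.
  by rewrite indicE mem_setE in_itv/= EFinM.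
have mf k : measurable_fun `[s, t]
    (fun x : R => ((c k)%:E * (\1_(`[a k, b k]) x)%:E)%E).
  apply: (measurable_funS measurableT) => //.
  by apply: emeasurable_funM => //; apply/measurable_EFinP; exact: measurable_indic.
have f0 k x : (0 <= (c k)%:E * (\1_(`[a k, b k]) x)%:E)%E.
  by rewrite mule_ge0// lee_fin.
rewrite EFinM -leI// -integral_cst//.
apply: (@le_trans _ _ (\int[lebesgue_measure]_(x in `[s, t])
    \sum_(0 <= k <oo) ((c k)%:E * (\1_(`[a k, b k]) x)%:E)))%E.
  apply: ge0_le_integral => //.
  - refine (@ge0_emeasurable_sum _ _ _ _ _ xpredT _ _); move=> *; [exact: f0|exact: mf].
  - move=> x /=; rewrite in_itv/= => /cov /le_trans; apply.
    by under eq_eseriesr do rewrite fE.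
rewrite integral_nneseries//.
apply: lee_nneseries => k *; first exact: integral_ge0.
rewrite ge0_integralZl_EFin//; last first.
  apply: (measurable_funS measurableT) => //.
  by apply/measurable_EFinP; exact: measurable_indic.
rewrite EFinM lee_wpmul2l ?lee_fin// integral_indic// -leI//.
by rewrite le_measure ?inE//; exact: measurableI.
Qed.

(* The weights [c k] absorb the side lengths of the coordinates that have already been integrated. *)
Lemma weighted_cover_box n (c : nat -> R) (a b : nat -> nat -> R) (C : R)
    (s t : nat -> R) :
  (forall k, 0 <= c k) -> (forall k i, a k i <= b k i) -> 0 <= C ->
  (forall i, s i <= t i) ->
  (forall x : nat -> R, (forall i, (i < n)%N -> s i <= x i <= t i) ->
    (C%:E <= \sum_(0 <= k <oo)
      (c k * [forall i : 'I_n, (a k i <= x i <= b k i)%R]%:R)%:E)%E) ->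
  ((C * \prod_(i < n) (t i - s i))%:E <=
   \sum_(0 <= k <oo) (c k * \prod_(i < n) (b k i - a k i))%:E)%E.
Proof.
elim: n c C => [|n IH] c C c0 ab C0 st cov.
  rewrite big_ord0 mulr1; apply: le_trans (cov s _) _ => //.
  apply: lee_nneseries => k *; first by rewrite lee_fin mulr_ge0.
  by rewrite big_ord0 lee_fin ler_wpM2l// lern1 leq_b1.
rewrite big_ord_recr/= [X in C * X]mulrC mulrA.
apply: le_trans (IH (fun k => c k * (b k n - a k n)) (C * (t n - s n)) _ _ _ _ _) _ => //.
- by move=> k; rewrite mulr_ge0// subr_ge0.
- by rewrite mulr_ge0// subr_ge0.
- move=> x sxt.
  (* With the first [n] coordinates frozen at [x], a box that misses them gets weight zero, and the
     last coordinate is integrated out. *)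
  apply: le_trans (weighted_cover_itv
    (c := fun k => c k * [forall i : 'I_n, a k i <= x i <= b k i]%:R)
    (a := a ^~ n) (b := b ^~ n) _ _ _ _ _) _ => //.
  + by move=> k; rewrite mulr_ge0.
  + move=> y sy.
    have := cov (fun i => if i == n then y else x i) => /(_ _)/le_trans; apply.
      move=> i; rewrite ltnS leq_eqVlt => /predU1P[->|lin]; first by rewrite eqxx.
      by rewrite ltn_eqF// sxt.
    apply: lee_nneseries => k *; first by rewrite lee_fin mulr_ge0.
    rewrite lee_fin -mulrA ler_wpM2l// -natrM ler_nat mulnb.
    case: (boolP [forall i : 'I_n.+1, _]) => // /forallP h.
    rewrite lt0b; apply/andP; split.
      apply/forallP => i; have := h (widen_ord (leqnSn n) i) => /=.
      by rewrite ltn_eqF.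
    by have := h ord_max; rewrite /= eqxx.
  + apply: lee_nneseries => k *; last by rewrite mulrAC.
    by rewrite lee_fin !mulr_ge0// subr_ge0.
- apply: lee_nneseries => k *.
    by rewrite lee_fin !mulr_ge0// ?subr_ge0// prodr_ge0// => i _; rewrite subr_ge0.
  by rewrite big_ord_recr/= -mulrA [X in c k * X]mulrC.
Qed.

End cover_integral.

(** * Lebesgue outer measure: boxes, subadditivity, translations *)

Section lebesgue_outer.
Context {R : realType} {n : nat}.
Implicit Types (a b x : 'rV[R]_n) (A B : set 'rV[R]_n).

Definition box a b : set 'rV[R]_n := [set x | forall i, a 0 i <= x 0 i <= b 0 i].

Definition box_vol a b : R := \prod_i (b 0 i - a 0 i).

Lemma box_vol_ge0 a b : (forall i, a 0 i <= b 0 i) -> 0 <= box_vol a b.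
Proof. by move=> ab; apply: prodr_ge0 => i _; rewrite subr_ge0. Qed.

Lemma lebesgue_rV_ge0 A : (0 <= lebesgue_rV A)%E.
Proof.
apply: le_ereal_inf_tmp => _ [a [b [ab _ ->]]].
by apply: nneseries_ge0 => k *; rewrite lee_fin box_vol_ge0.
Qed.

Lemma le_lebesgue_rV A B : A `<=` B -> (lebesgue_rV A <= lebesgue_rV B)%E.
Proof.
move=> AB; apply: le_ereal_inf_tmp => _ [a [b [ab cB ->]]].
apply: ereal_inf_lbound; exists a, b; split => //.
exact: subset_trans cB.
Qed.

Lemma lebesgue_rV_box_ge a b : (forall i, a 0 i <= b 0 i) ->
  ((box_vol a b)%:E <= lebesgue_rV (box a b))%E.
Proof.
move=> ab; apply: le_ereal_inf_tmp => _ [p [q [pq cov ->]]].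
(* Row vectors become sequences, padded with 0 beyond [n], to fit the induction on the dimension. *)
pose ext (x : 'rV[R]_n) (i : nat) : R := oapp (x 0) 0 (insub i).
have extE x (i : 'I_n) : ext x i = x 0 i by rewrite /ext valK.
have ext_le (x y : 'rV[R]_n) : (forall i, x 0 i <= y 0 i) -> forall i, ext x i <= ext y i.
  by move=> xy i; rewrite /ext; case: insub.
have volE x y : \prod_(i < n) (ext y i - ext x i) = box_vol x y.
  by apply: eq_bigr => i _; rewrite !extE.
have := @weighted_cover_box R n (fun=> 1) (fun k => ext (p k))
  (fun k => ext (q k)) 1 (ext a) (ext b).
rewrite mul1r volE.
move=> /(_ _ _ _ _ _)/le_trans; apply => //.
- by move=> k i; exact: ext_le.
- by move=> i; exact: ext_le.
- move=> x abx.
  have [k _ kx] : (\bigcup_k box (p k) (q k)) (\row_i x i).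
    by apply: cov => i; rewrite mxE; have := abx i (ltn_ord i); rewrite !extE.
  (* All terms are nonnegative, and the term of the box that contains the point is already 1. *)
  apply: le_trans (nneseries_lim_ge k.+1 _); last first.
    by move=> *; rewrite lee_fin mulr_ge0.
  rewrite big_mkord big_ord_recr/= -[leLHS]add0e leeD//.
    by apply: sume_ge0 => *; rewrite lee_fin mulr_ge0.
  rewrite lee_fin mul1r (_ : [forall _, _] = true)//.
  by apply/forallP => i; have := kx i; rewrite mxE !extE.
- apply: lee_nneseries => k *.
    by rewrite lee_fin mulr_ge0// prodr_ge0// => i _; rewrite subr_ge0 ext_le.
  by rewrite mul1r volE.
Qed.

(** Nearly optimal covers of the [F k], with error [e / 2 ^ k.+1], are merged into a single sequence
    through a bijection of [nat] with [nat * nat]. *)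
Lemma lebesgue_rV_sigma_subadditive A (F : nat -> set 'rV[R]_n) :
  A `<=` \bigcup_k F k ->
  (lebesgue_rV A <= \sum_(0 <= k <oo) lebesgue_rV (F k))%E.
Proof.
move=> AF; apply: le_trans (le_lebesgue_rV AF) _.
(* Nearly optimal covers require finite measures; one infinite term makes the right-hand side
   infinite. *)
have [[i ioo]|] := pselect (exists i, lebesgue_rV (F i) = +oo%E).
  rewrite (eseries_pinfty _ _ ioo) ?leey// => k _.
  by rewrite -ltNye (lt_le_trans _ (lebesgue_rV_ge0 _)).
rewrite -forallNE => Foo.
apply/lee_addgt0Pr => e e0.
apply: le_trans (epsilon_trick xpredT (fun k => lebesgue_rV_ge0 _) (ltW e0)).
pose P k (ab : nat -> 'rV[R]_n * 'rV[R]_n) :=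
  [/\ forall l i, (ab l).1 0 i <= (ab l).2 0 i,
      F k `<=` \bigcup_l box (ab l).1 (ab l).2 &
  (\sum_(0 <= l <oo) (box_vol (ab l).1 (ab l).2)%:E <=
    lebesgue_rV (F k) + (e / (2 ^ k.+1)%:R)%:E)%E].
have [G PG] : {G : nat -> nat -> 'rV[R]_n * 'rV[R]_n & forall k, P k (G k)}.
  apply: (@choice _ _ P) => k.
  have Ffin : lebesgue_rV (F k) \is a fin_num.
    by rewrite ge0_fin_numE ?lebesgue_rV_ge0// ltey; apply/eqP; exact: Foo.
  have ek : 0 < e / (2 ^ k.+1)%:R by rewrite divr_gt0// ltr0n expn_gt0.
  have [_ [a [b [ab cF ->]]] lt] := lb_ereal_inf_adherent ek Ffin.
  by exists (fun l => (a l, b l)); split => //; exact: ltW.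
pose v (kl : nat * nat) := (box_vol (G kl.1 kl.2).1 (G kl.1 kl.2).2)%:E.
have v0 kl : (0 <= v kl)%E.
  by rewrite lee_fin box_vol_ge0//; have [] := PG kl.1.
have /card_esym/ppcard_eqP[f] := card_nat2.
apply: (@le_trans _ _ (\sum_(0 <= k <oo) v (f k)))%E.
  apply: ereal_inf_lbound.
  exists (fun k => (G (f k).1 (f k).2).1), (fun k => (G (f k).1 (f k).2).2).
  split => //; first by move=> k i; have [] := PG (f k).1.
  move=> x [k _ Fx]; have [_ /(_ _ Fx) [l _ xl] _] := PG k.
  by exists (f^-1%FUN (k, l)) => //=; rewrite invK ?inE.
rewrite nneseries_esumT//.
rewrite -(@reindex_esum _ _ _ [set: nat] [set: nat * nat] f v); last exact: 'bij_f.
apply: (@le_trans _ _ (\sum_(0 <= k <oo) \sum_(0 <= l <oo) v (k, l)))%E.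
  rewrite nneseries_esumT; last by move=> k *; exact: nneseries_ge0.
  under [leRHS]eq_esum do rewrite nneseries_esumT//.
  rewrite esum_esum//.
  by rewrite (_ : setT = [set: nat] `*`` (fun=> setT)) //; apply/seteqP; split.
by apply: lee_nneseries => k *; [exact: nneseries_ge0|have [] := PG k].
Qed.

(** The cover is completed by the one-point boxes [box (a k) (a k)]; their volume vanishes because
    [0 < n] makes the product nonempty. *)
Lemma lebesgue_rV_finite_cover A N (a b : nat -> 'rV[R]_n) : (0 < n)%N ->
  (forall k i, a k 0 i <= b k 0 i) ->
  A `<=` [set x | exists2 k, (k < N)%N & box (a k) (b k) x] ->
  (lebesgue_rV A <= (\sum_(k < N) box_vol (a k) (b k))%:E)%E.
Proof.
move=> n0 ab cov; apply: ereal_inf_lbound.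
exists a, (fun k => if (k < N)%N then b k else a k); split.
- by move=> k i; case: ifP.
- by move=> x /cov[k kN xk]; exists k => //=; rewrite kN.
- rewrite (nneseries_split 0 N); last first.
    by move=> k *; rewrite lee_fin prodr_ge0// => i _; case: ifP; rewrite subr_ge0.
  rewrite add0n big_mkord [X in (_ + X)%E]eseries0 ?adde0; last first.
    move=> k kN _; rewrite ltnNge kN/= (bigD1 (Ordinal n0))//=.
    by rewrite subrr mul0r.
  by rewrite -sumEFin; apply: eq_bigr => k _; rewrite ltn_ord.
Qed.

Lemma lebesgue_rV_box_le a b : (0 < n)%N -> (forall i, a 0 i <= b 0 i) ->
  (lebesgue_rV (box a b) <= (box_vol a b)%:E)%E.
Proof.
move=> n0 ab; have := @lebesgue_rV_finite_cover (box a b) 1 (fun=> a) (fun=> b) n0.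
rewrite big_ord1; apply => //.
by move=> x ?; exists 0%N.
Qed.

Lemma lebesgue_rV_translate A x :
  (lebesgue_rV [set (y + x)%R | y in A] <= lebesgue_rV A)%E.
Proof.
apply: le_ereal_inf_tmp => _ [a [b [ab cov ->]]].
apply: ereal_inf_lbound; exists (fun k => a k + x), (fun k => b k + x); split.
- by move=> k i; rewrite !mxE lerD2r.
- by move=> _ [y /cov[k _ yk] <-]; exists k => // i; rewrite !mxE !lerD2r.
- apply: eq_eseriesr => k _; congr EFin.
  by apply: eq_bigr => i _; rewrite !mxE; ring.
Qed.

End lebesgue_outer.

(** * Volume of linear images *)

Section linear_images.
Context {R : realType}.

(** The product is a polynomial in [h] with nonnegative coefficients, so on [[0, 1]] it grows at
    most linearly. This controls how much larger than a thin slab the box around its image is. *)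
Lemma prod_perturb (I : Type) (s : seq I) (P : pred I) (w c : I -> R) :
  (forall i, 0 <= w i) -> (forall i, 0 <= c i) ->
  exists2 K, 0 <= K & forall h, 0 <= h <= 1 ->
    \prod_(i <- s | P i) (w i + c i * h) <= \prod_(i <- s | P i) w i + K * h.
Proof.
move=> w0 c0; elim: s => [|i s [K K0 IH]].
  by exists 0 => // h _; rewrite !big_nil mul0r addr0.
set p := \prod_(j <- s | P j) w j in IH *.
have p0 : 0 <= p by exact: prodr_ge0.
(* Obtained by expanding [(w i + c i * h) * (p + K * h)] with [h ^+ 2 <= h]; the summand 1 covers an
   index rejected by [P]. *)
exists (c i * (p + K) + (w i + 1) * K).
  by rewrite addr_ge0// mulr_ge0// addr_ge0.
move=> h h01; rewrite !big_cons -/p; have := IH h h01.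
move: (\prod_(_ <- _ | _) (_ + _)) => q qle.
have [h0 h1] := andP h01; have wi := w0 i; have ci := c0 i.
case: ifP => _; last first.
  apply: le_trans qle _; rewrite lerD2l ler_wpM2r//.
  have : 0 <= c i * (p + K) by rewrite mulr_ge0// addr_ge0.
  have : 0 <= w i * K by rewrite mulr_ge0.
  lra.
apply: (@le_trans _ _ ((w i + c i * h) * (p + K * h))).
  by rewrite ler_wpM2l// addr_ge0// mulr_ge0.
have : 0 <= K * h by rewrite mulr_ge0.
have : 0 <= c i * K * h * (1 - h).
  by rewrite !mulr_ge0// subr_ge0.
by move=> h2 h3; nra.
Qed.

Lemma subinterval_index (a d t : R) N : a <= t <= a + N.+1%:R * d ->
  exists2 l, (l <= N)%N & a + l%:R * d <= t <= a + l.+1%:R * d.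
Proof.
elim: N => [|N IH] /andP[at_ tN].
  by exists 0%N => //; rewrite mul0r addr0 at_.
have [tN'|/ltW tN'] := leP t (a + N.+1%:R * d).
  have [l lN lt] := IH (introT andP (conj at_ tN')).
  by exists l => //; exact: leqW.
by exists N.+1 => //; rewrite tN'.
Qed.

Context {n : nat}.
Implicit Types (N : 'M[R]_n) (A : set 'rV[R]_n) (v : 'rV[R]_n) (j : 'I_n).

(* As [x |-> x *m row_subst j v], this adds multiples of the coordinate j to the other
   coordinates and scales it by [v 0 j]. *)
Definition row_subst j v : 'M[R]_n :=
  \matrix_(i, k) if i == j then v 0 k else (i == k)%:R.

(** Expand along row [j]: its cofactors do not see that row, hence agree with those of the
    identity. *)
Lemma det_row_subst j v : \det (row_subst j v) = v 0 j.
Proof.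
rewrite (expand_det_row _ j).
have cof k : cofactor (row_subst j v) j k = (k == j)%:R.
  have -> : cofactor (row_subst j v) j k = cofactor 1%:M j k.
    congr (_ * \det _); apply/matrixP => p q.
    by rewrite !mxE eq_sym (negbTE (neq_lift _ _)).
  have := mul1mx (\adj (1%:M : 'M[R]_n)).
  by rewrite mul_mx_adj det1 => /matrixP/(_ k j); rewrite !mxE => <-.
under eq_bigr do rewrite cof mxE eqxx.
by rewrite (bigD1 j)//= eqxx mulr1 big1 ?addr0// => k /negbTE->; rewrite mulr0.
Qed.

Lemma mul_row_subst j v (x : 'rV[R]_n) k :
  (x *m row_subst j v) 0 k = (if k == j then 0 else x 0 k) + x 0 j * v 0 k.
Proof.
rewrite mxE (bigD1 j)//= mxE eqxx addrC; congr (_ + _).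
transitivity (\sum_(i | i != j) x 0 i * (i == k)%:R).
  by apply: eq_bigr => i /negbTE ij; rewrite mxE ij.
case: eqVneq => [->|kj].
  by rewrite big1// => i /negbTE->; rewrite mulr0.
rewrite (bigD1 k)//= eqxx mulr1 big1 ?addr0// => i /andP[_ /negbTE->].
by rewrite mulr0.
Qed.

(** One inequality suffices, as the inverse matrix provides the other. *)
Definition volume_scaling N :=
  forall A, (lebesgue_rV [set x *m N | x in A] <= `|\det N|%:E * lebesgue_rV A)%E.

(** The images of the boxes of a cover of [A] cover the image of [A], so countable subadditivity
    carries the bound from boxes to all sets. *)
Lemma volume_scaling_box N : \det N != 0 ->
  (forall a b : 'rV[R]_n, (forall i, a 0 i <= b 0 i) ->
    (lebesgue_rV [set x *m N | x in box a b] <= (`|\det N| * box_vol a b)%:E)%E) ->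
  volume_scaling N.
Proof.
move=> N0 boxN A; have d0 : 0 < `|\det N| by rewrite normr_gt0.
rewrite -lee_pdivrMl//; apply: le_ereal_inf_tmp => _ [a [b [ab cov ->]]].
rewrite lee_pdivrMl// -nneseriesZl; last first.
  by move=> k _; rewrite lee_fin box_vol_ge0.
apply: le_trans (lebesgue_rV_sigma_subadditive
  (F := fun k => [set x *m N | x in box (a k) (b k)]) _) _.
  by move=> _ [x /cov[k _ xk] <-]; exists k => //; exists x.
apply: lee_nneseries => k *; first exact: lebesgue_rV_ge0.
by rewrite -EFinM; exact: boxN.
Qed.

Lemma volume_scaling_mul N1 N2 :
  volume_scaling N1 -> volume_scaling N2 -> volume_scaling (N1 *m N2).
Proof.
move=> s1 s2 A; rewrite det_mulmx normrM mulrC EFinM -muleA.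
have -> : [set x *m (N1 *m N2) | x in A] =
    [set x *m N2 | x in [set x *m N1 | x in A]].
  by rewrite image_comp; apply: eq_imagel => x _; rewrite mulmxA.
by apply: le_trans (s2 _) _; rewrite lee_wpmul2l ?lee_fin.
Qed.

(* A box is cut into slabs orthogonal to the axis j; the image of a thin slab fits in a box
   that is barely larger than the slab. *)
Lemma volume_scaling_row_subst j v : v 0 j != 0 -> volume_scaling (row_subst j v).
Proof.
move=> vj0; apply: volume_scaling_box => [|a b ab]; rewrite det_row_subst//.
have n0 : (0 < n)%N by case: j {vj0} => i; case: n.
pose s := b 0 j - a 0 j; have s0 : 0 <= s by rewrite subr_ge0.
pose w k := if k == j then 0 else b 0 k - a 0 k.
pose c k := `|v 0 k| * s.
have w0 k : 0 <= w k by rewrite /w; case: ifP; rewrite ?subr_ge0.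
have c0 k : 0 <= c k by rewrite mulr_ge0.
have [K K0 Kle] := prod_perturb (index_enum 'I_n) (fun k => k != j) w0 c0.
(* With [m.+1] slabs of height [d], the excess over the exact volume is of order [1 / m.+1]. *)
have step (m : nat) : (lebesgue_rV [set x *m row_subst j v | x in box a b] <=
    (`|v 0 j| * s * (\prod_(k | k != j) w k + K / m.+1%:R))%:E)%E.
  have m0 : m.+1%:R != 0 :> R by rewrite pnatr_eq0.
  pose d := s / m.+1%:R.
  have d0 : 0 <= d by rewrite divr_ge0.
  (* Box around the image of slab [l]. At mid-height [a 0 j + (l + 1/2) * d] the shift is exact; a
     deviation of at most [d / 2] moves coordinate [k] by at most [|v 0 k| * d / 2]. *)
  pose lo (l : nat) : 'rV[R]_n := \row_k
    ((if k == j then 0 else a 0 k) + (a 0 j + (l%:R + 2^-1) * d) * v 0 k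
     - `|v 0 k| * d / 2).
  pose hi (l : nat) : 'rV[R]_n := \row_k
    ((if k == j then 0 else b 0 k) + (a 0 j + (l%:R + 2^-1) * d) * v 0 k
     + `|v 0 k| * d / 2).
  have vd k : 0 <= `|v 0 k| * d by rewrite mulr_ge0.
  apply: le_trans (@lebesgue_rV_finite_cover _ _ _ m.+1 lo hi n0 _ _) _.
  - move=> l k; rewrite !mxE; have := vd k; have := ab k.
    by case: ifP => _ *; lra.
  - move=> _ [x abx <-].
    have /subinterval_index[l lN xl] : a 0 j <= x 0 j <= a 0 j + m.+1%:R * d.
      by rewrite mulrC divfK ?pnatr_eq0// /s subrKC.
    exists l => // k; rewrite mul_row_subst !mxE.
    have dist : `|x 0 j - (a 0 j + (l%:R + 2^-1) * d)| <= d / 2.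
      by move: xl; rewrite -natr1 ler_norml => /andP[? ?]; apply/andP; split; lra.
    have := ler_wpM2l (normr_ge0 (v 0 k)) dist.
    rewrite -normrM mulrBr ler_norml mulrA => /andP[? ?].
    by have := abx k; case: ifP => _ => [_|/andP[? ?]]; apply/andP; split; lra.
  rewrite lee_fin (eq_bigr (fun=> `|v 0 j| * d * \prod_(k | k != j) (w k + c k * m.+1%:R^-1))).
    rewrite sumr_const card_ord -[leLHS]mulr_natr.
    rewrite [leLHS](_ : _ = `|v 0 j| * s * \prod_(k | k != j) (w k + c k * m.+1%:R^-1)).
      apply: ler_wpM2l; first exact: mulr_ge0.
      by apply: Kle; rewrite invr_ge0 ler0n/= invf_le1// ler1n.
    by rewrite /d; move: m.+1%:R m0 => M M0; field.
  move=> l _; rewrite /box_vol (bigD1 j)//=; congr (_ * _).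
    by rewrite !mxE eqxx; field.
  apply: eq_bigr => k /negbTE kj; rewrite !mxE kj /w kj /c /d.
  by move: m.+1%:R m0 => M M0; field.
apply/lee_addgt0Pr => e e0.
(* Enough slabs for the excess to stay below [e]. *)
pose m := Num.truncn (`|v 0 j| * s * K / e).
apply: le_trans (step m) _; rewrite -EFinD lee_fin mulrDr.
have -> : box_vol a b = s * \prod_(k | k != j) w k.
  rewrite /box_vol (bigD1 j)//=; congr (_ * _).
  by apply: eq_bigr => k /negbTE kj; rewrite /w kj.
rewrite [X in _ <= X + _]mulrA lerD2l [X in X <= _]mulrA ler_pdivrMr// -ler_pdivrMl//.
by rewrite mulrC; apply/ltW/truncnS_gt.
Qed.

Lemma row_subst_e j : row_subst j (delta_mx 0 j) = 1%:M.
Proof.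
by apply/matrixP => i k; rewrite !mxE eqxx/=; case: (eqVneq i j) => // ->; rewrite eq_sym.
Qed.

(* Column reduction: [N] is a product of matrices [row_subst]. *)
Lemma volume_scaling_unit N : \det N != 0 -> volume_scaling N.
Proof.
have [j0|] := pickP 'I_n; last first.
  move=> n0 _ A; case: n N n0 A => [|m] N n0 A; last by have := n0 ord0.
  rewrite det_mx00 normr1 mul1e le_lebesgue_rV// => _ [x Ax <-].
  by rewrite (_ : _ *m _ = x)//; apply/rowP => -[].
move=> _.
(* Induction on the number [k] of rows still to be reduced: the first [n - k] rows are already those
   of the identity. *)
suff H k : (k <= n)%N -> forall N, \det N != 0 ->
    (forall i : 'I_n, (i < n - k)%N -> row i N = delta_mx 0 i) -> volume_scaling N.
  by move=> N0; apply: (H n) => // i; rewrite subnn.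
elim: k => [|k IH] kn {}N N0 rowN.
  have -> : N = 1%:M.
    by apply/row_matrixP => i; rewrite rowN ?subn0// row1.
  by rewrite -(row_subst_e j0); apply: volume_scaling_row_subst; rewrite mxE !eqxx oner_eq0.
have [kn' kE] : (n - k.+1 < n)%N /\ (n - k = (n - k.+1).+1)%N.
  by split; [rewrite ltn_subrL/=; exact: leq_ltn_trans kn|rewrite subnSK].
pose i0 := Ordinal kn'.
(* Nonzero pivot. Right multiplication by [row_subst i0 v'], the inverse of the matrix built from
   the pivot row [v], turns that row into a unit vector and preserves the earlier ones. *)
have base N' : \det N' != 0 -> N' i0 i0 != 0 ->
    (forall i : 'I_n, (i < n - k.+1)%N -> row i N' = delta_mx 0 i) -> volume_scaling N'.
  move=> N'0 piv rowN'.
  pose v := row i0 N'.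
  pose v' : 'rV[R]_n := \row_k (if k == i0 then (v 0 i0)^-1 else - v 0 k / v 0 i0).
  have vE : v 0 i0 = N' i0 i0 by rewrite mxE.
  have inv : row_subst i0 v' *m row_subst i0 v = 1%:M.
    apply/row_matrixP => i; rewrite row_mul row1; apply/rowP => q.
    rewrite mul_row_subst !mxE eqxx/= -/v.
    case: (eqVneq i i0) => [->|ii0].
      case: (eqVneq q i0) => [->|qi0]; first by rewrite add0r mulVf.
      by rewrite /=; field.
    rewrite mul0r addr0; case: eqVneq => [->|_]; last by rewrite eq_sym.
    by rewrite eq_sym (negbTE ii0).
  have -> : N' = (N' *m row_subst i0 v') *m row_subst i0 v.
    by rewrite -mulmxA inv mulmx1.
  apply: volume_scaling_mul; last by apply: volume_scaling_row_subst; rewrite vE.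
  apply: IH; first exact: ltnW.
    by rewrite det_mulmx det_row_subst mulf_neq0// mxE eqxx vE invr_eq0.
  move=> i; rewrite kE ltnS leq_eqVlt row_mul => /predU1P[ii0|ik].
    have -> : i = i0 by exact/val_inj.
    apply/rowP => q; rewrite mul_row_subst !mxE eqxx/=.
    case: (eqVneq q i0) => [_|qi0]; first by rewrite add0r mulfV.
    by rewrite /=; field.
  rewrite rowN'//; apply/rowP => q; rewrite mul_row_subst !mxE eqxx/=.
  have /negbTE-> : i0 != i by rewrite -val_eqE/= gtn_eqF.
  rewrite mul0r addr0; case: (eqVneq q _) => // ->.
  by rewrite -val_eqE/= gtn_eqF.
have [piv|] := eqVneq (N i0 i0) 0; last by move=> piv; exact: base.
(* Zero pivot. If the pivot row also vanished to the right, it would combine earlier unit rows and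
   so be fixed by [N]; then [x] below would be a nonzero vector in the left kernel. *)
have [j /andP[ji0 Nj]] : exists j : 'I_n, (i0 < j)%N && (N i0 j != 0).
  apply/existsP; apply: contraT => /existsPn h.
  pose x : 'rV[R]_n := delta_mx 0 i0 - row i0 N.
  suff xN : x *m N = 0.
    have : \det N == 0 by apply/det0P; exists x => //; apply/eqP => /rowP/(_ i0);
      rewrite !mxE !eqxx piv subr0 => /eqP; rewrite oner_eq0.
    by rewrite (negbTE N0).
  rewrite mulmxBl -rowE; apply/eqP; rewrite subr_eq0; apply/eqP.
  rewrite [RHS]mulmx_sum_row [LHS]row_sum_delta.
  apply: eq_bigr => i _; have [ii0|ii0] := ltnP i i0; first by rewrite (rowN i).
  suff -> : row i0 N 0 i = 0 by rewrite !scale0r.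
  rewrite mxE; move: ii0; rewrite leq_eqVlt => /predU1P[/val_inj<-//|ii0].
  by have := h i; rewrite ii0 negbK => /eqP.
have ji : j != i0 by rewrite -val_eqE/= gtn_eqF.
(* Adding column [j] to column [i0] makes the pivot nonzero; [u (-1)] undoes the operation. *)
pose u (c : R) : 'rV[R]_n := delta_mx 0 j + c *: delta_mx 0 i0.
have inv : row_subst j (u 1) *m row_subst j (u (-1)) = 1%:M.
  apply/row_matrixP => i; rewrite row_mul row1; apply/rowP => q.
  rewrite mul_row_subst !mxE eqxx/= eqxx (negbTE ji) mulr0 addr0.
  case: (eqVneq i j) => [->|ij].
    case: (eqVneq q j) => [->|qj]; first by rewrite (negbTE ji)/=; ring.
    by rewrite /=; ring.
  rewrite mul0r addr0; case: (eqVneq q j) => [->|_].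
    by rewrite eq_sym (negbTE ij).
  by rewrite eq_sym.
have -> : N = (N *m row_subst j (u 1)) *m row_subst j (u (-1)).
  by rewrite -mulmxA inv mulmx1.
have uj c : u c 0 j = 1.
  by rewrite !mxE !eqxx (negbTE ji) mulr0 addr0.
apply: volume_scaling_mul; last first.
  by apply: volume_scaling_row_subst; rewrite uj oner_eq0.
apply: base.
- by rewrite det_mulmx det_row_subst uj mulr1.
- have := mul_row_subst j (u 1) (row i0 N) i0.
  rewrite -row_mul mxE => ->; rewrite (eq_sym i0) (negbTE ji) !mxE piv add0r.
  by rewrite !eqxx (eq_sym i0) (negbTE ji) add0r !mulr1.
- move=> i ik; rewrite row_mul rowN//; apply/rowP => q.
  rewrite mul_row_subst !mxE eqxx/=.
  have /negbTE-> : j != i by rewrite -val_eqE/= gtn_eqF// (ltn_trans ik).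
  rewrite mul0r addr0; case: (eqVneq q _) => // ->.
  by rewrite -val_eqE/= gtn_eqF// (ltn_trans ik).
Qed.

End linear_images.

(** * Topology and convexity of row vectors *)

Section row_topology.
Context {R : realType}.

(** Balls of the canonical norm are cubes, so neighbourhoods are tested on coordinates. *)
Lemma nbhs_rVP n (x : 'rV[R]_n) (A : set 'rV[R]_n) :
  nbhs x A <-> exists2 e, 0 < e & forall y : 'rV[R]_n, (forall i, `|y 0 i - x 0 i| < e) -> A y.
Proof.
split=> [/nbhs_ballP[e /= e0 xeA]|[e e0 xeA]].
  exists e => // y yx; apply: xeA; split => // i j.
  by rewrite ord1 /ball/= distrC.
apply/nbhs_ballP; exists e => //= y [_ yx]; apply: xeA => i.
by have := yx 0 i; rewrite /ball/= distrC.
Qed.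

Lemma continuous_sumr (T : topologicalType) (I : Type) (s : seq I) (P : pred I)
    (f : I -> T -> R) (x : T) : (forall i, P i -> {for x, continuous (f i)}) ->
  {for x, continuous (fun y => \sum_(i <- s | P i) f i y)}.
Proof.
move=> fc; elim: s => [|i s IH].
  rewrite (_ : (fun _ => _) = fun=> 0); first exact: cst_continuous.
  by apply/funext => y; rewrite big_nil.
have [Pi|Pi] := boolP (P i); last first.
  rewrite (_ : (fun _ => _) = fun y => \sum_(i <- s | P i) f i y)//.
  by apply/funext => y; rewrite big_cons (negbTE Pi).
rewrite (_ : (fun _ => _) = f i + fun y => \sum_(i <- s | P i) f i y).
  by apply: continuousD => //; exact: fc.
by apply/funext => y; rewrite big_cons Pi.
Qed.

Lemma continuous_rV (T : topologicalType) n (f : T -> 'rV[R]_n) :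
  (forall i, continuous (fun x => f x 0 i)) -> continuous f.
Proof.
move=> fc x A /nbhs_rVP[e e0 fxA].
have H : nbhs x [set y | forall i : 'I_n, `|f y 0 i - f x 0 i| < e].
  apply: filter_forall => i.
  by have := fc i x => /cvgrPdist_lt/(_ e e0); apply: filterS => y; rewrite distrC.
by move: H; apply: filterS => y; exact: fxA.
Qed.

Lemma continuous_mulmx_coord m n (N : 'M[R]_(m, n)) j :
  continuous (fun x : 'rV[R]_m => (x *m N) 0 j).
Proof.
move=> x.
rewrite (_ : (fun _ => _) = fun x : 'rV[R]_m => \sum_i x 0 i * N i j); last first.
  by apply/funext => y; rewrite mxE.
apply: continuous_sumr => i _; apply: continuousM; last exact: cst_continuous.
exact: coord_continuous.
Qed.

Lemma continuous_affine_coord m n (N : 'M[R]_(m, n)) c j :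
  continuous (fun x : 'rV[R]_m => (x *m N + c) 0 j).
Proof.
move=> x; rewrite (_ : (fun _ => _) = (fun x : 'rV[R]_m => (x *m N) 0 j) + fun=> c 0 j).
  by apply: continuousD; [exact: continuous_mulmx_coord|exact: cst_continuous].
by apply/funext => y; rewrite mxE.
Qed.

Lemma continuous_affine m n (N : 'M[R]_(m, n)) c :
  continuous (fun x : 'rV[R]_m => x *m N + c).
Proof. by apply: continuous_rV => j; exact: continuous_affine_coord. Qed.

Lemma continuous_dotl n (p : 'rV[R]_n) : continuous (fun x => dot p x).
Proof.
move=> x; apply: continuous_sumr => i _.
by apply: continuousM; [exact: cst_continuous|exact: coord_continuous].
Qed.

Lemma compact_box n (a b : 'rV[R]_n) : compact (box a b).
Proof.
rewrite (_ : box a b = [set v | forall i, `[a 0 i, b 0 i]%classic (v ord0 i)]).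
  by apply: (@rV_compact _ _ (fun i => `[a 0 i, b 0 i]%classic)) => i; exact: segment_compact.
by apply/seteqP; split => x /= xab i; have := xab i; rewrite in_itv.
Qed.

Lemma compact_borel n (A : set 'rV[R]_n) : compact A -> borel_rV A.
Proof.
move=> /compact_closed cA; rewrite /borel_rV -[A]setCK; apply: sigma_algebraC.
by apply: sub_sigma_algebra; apply: closed_openC; apply: cA; exact: norm_hausdorff.
Qed.

Lemma continuous_image_compact (T U : topologicalType) (f : T -> U) (A : set T) :
  continuous f -> compact A -> compact (f @` A).
Proof. by move=> fc cA; apply: (continuous_compact _ cA); exact: continuous_subspaceT. Qed.

Lemma within_continuousB (T : topologicalType) (A : set T) (f g : T -> R) :
  {within A, continuous f} -> {within A, continuous g} ->
  {within A, continuous (fun x => f x - g x)}.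
Proof.
move=> fc gc x; exact: (@continuousB R R (subspace A) f g x (fc x) (gc x)).
Qed.

End row_topology.

Section dot.
Context {R : realType} {n : nat}.
Implicit Types x y z : 'rV[R]_n.

Lemma dotDr x y z : dot x (y + z) = dot x y + dot x z.
Proof. by rewrite -big_split/=; apply: eq_bigr => i _; rewrite mxE mulrDr. Qed.

Lemma dotDl x y z : dot (x + y) z = dot x z + dot y z.
Proof. by rewrite -big_split/=; apply: eq_bigr => i _; rewrite mxE mulrDl. Qed.

Lemma dotZr a x y : dot x (a *: y) = a * dot x y.
Proof. by rewrite mulr_sumr; apply: eq_bigr => i _; rewrite mxE mulrCA. Qed.

Lemma dotNr x y : dot x (- y) = - dot x y.
Proof. by rewrite -scaleN1r dotZr mulN1r. Qed.

Lemma dotBr x y z : dot x (y - z) = dot x y - dot x z.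
Proof. by rewrite dotDr dotNr. Qed.

Lemma dotr0 x : dot x 0 = 0.
Proof. by apply: big1 => i _; rewrite mxE mulr0. Qed.

Lemma dotC x y : dot x y = dot y x.
Proof. by apply: eq_bigr => i _; rewrite mulrC. Qed.

Lemma dot_mulmx_tr x y (N : 'M[R]_n) : dot (x *m N^T) y = dot x (y *m N).
Proof.
rewrite /dot; under eq_bigr do rewrite mxE mulr_suml.
rewrite exchange_big/=; apply: eq_bigr => i _.
by rewrite mxE mulr_sumr; apply: eq_bigr => k _; rewrite mxE; ring.
Qed.

End dot.

Section convexity.
Context {R : realType} {V : lmodType R}.

Lemma convex_setE (A : set V) x y (t : R) : convex_set A -> A x -> A y -> 0 <= t <= 1 ->
  A (t *: x + (1 - t) *: y).
Proof.
move=> cA Ax Ay /andP[t0 t1].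
exact: set_mem (cA x y (Itv01 t0 t1) (mem_set Ax) (mem_set Ay)).
Qed.

Lemma convex_functionE (A : set V) (u : V -> R) x y (t : R) :
  convex_function A u -> A x -> A y -> 0 <= t <= 1 ->
  u (t *: x + (1 - t) *: y) <= t * u x + (1 - t) * u y.
Proof.
move=> cu Ax Ay /andP[t0 t1].
exact: cu (Itv01 t0 t1) x y (mem_set Ax) (mem_set Ay).
Qed.

End convexity.

(** * Touching by a paraboloid *)

Section affine_images.
Context {R : realType} {n : nat}.
Implicit Types (N : 'M[R]_n) (A : set 'rV[R]_n) (c : 'rV[R]_n).

Lemma lebesgue_rV_affine_le N c A : \det N != 0 ->
  (lebesgue_rV (affine_map N c @` A) <= `|\det N|%:E * lebesgue_rV A)%E.
Proof.
move=> N0; apply: le_trans (volume_scaling_unit N0 A).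
rewrite /affine_map -(image_comp (fun x => x *m N) (fun x => x + c)).
exact: lebesgue_rV_translate.
Qed.

(** The upper bound, applied to the inverse affine map. *)
Lemma lebesgue_rV_affine_ge N c A : \det N != 0 ->
  (`|\det N|%:E * lebesgue_rV A <= lebesgue_rV (affine_map N c @` A))%E.
Proof.
move=> N0; have uN : N \in unitmx by rewrite unitmxE unitfE.
have d0 : 0 < `|\det N| by rewrite normr_gt0.
have iN0 : \det (invmx N) != 0 by rewrite det_inv invr_eq0.
rewrite -lee_pdivlMl// -normfV -det_inv.
apply: le_trans (lebesgue_rV_affine_le (- c *m invmx N) _ iN0).
apply: le_lebesgue_rV => x Ax; exists (affine_map N c x); first by exists x.
by rewrite /affine_map -mulmxDl addrK mulmxK.
Qed.

End affine_images.

Section touching.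
Context {R : realType} {n : nat}.
Variables (Omega : set 'rV[R]_n) (u : 'rV[R]_n -> R) (Lambda : R).
Hypotheses (n0 : (0 < n)%N) (oOmega : open Omega).
Hypothesis cu : convex_function Omega u.
Hypotheses (contu : {within Omega, continuous u}) (Lambda0 : 0 <= Lambda).
Hypothesis MAu : forall A : set 'rV[R]_n, borel_rV A -> A `<=` Omega ->
  (monge_ampere Omega u A <= Lambda%:E * lebesgue_rV A)%E.

(** In the coordinates given by [N] the parallelepiped has half-sides [r / d i] and the box of
    slopes has half-sides [d i * r / (2 * n)]. The powers of [r] cancel in the ratio of volumes, and
    [\det N] enters once from each side, hence squared. *)
Lemma touching_bound (N : 'M[R]_n) (x0 p : 'rV[R]_n) (d : 'I_n -> R) (rho : R) :
  \det N != 0 -> Omega x0 -> (forall i, 0 < d i) -> 0 < rho ->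
  (forall x, Omega x -> (forall i, `|((x - x0) *m N) 0 i| <= rho) ->
    u x0 + dot p (x - x0) + \sum_i (d i * ((x - x0) *m N) 0 i) ^+ 2 <= u x) ->
  (\det N) ^+ 2 * \prod_i (d i ^+ 2 / (2 * n%:R)) <= Lambda.
Proof.
move=> N0 Ox0 d0 rho0 touch.
have uN : N \in unitmx by rewrite unitmxE unitfE.
have nR0 : 0 < n%:R :> R by rewrite ltr0n.
pose g z := affine_map (invmx N) x0 z.
have gK z : (g z - x0) *m N = z by rewrite /g /affine_map addrK mulmxKV.
have Kg x : g ((x - x0) *m N) = x by rewrite /g /affine_map mulmxK// subrK.
have [e e0 geO] : exists2 e, 0 < e &
    forall z : 'rV[R]_n, (forall i, `|z 0 i| < e) -> Omega (g z).
  have : nbhs (0 : 'rV[R]_n) (g @^-1` Omega).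
    apply: (@continuous_affine R n n (invmx N) x0 0); apply: open_nbhs_nbhs.
    by split; rewrite ?mul0mx ?add0r.
  move=> /nbhs_rVP[e e0 he]; exists e => // z ze; apply: he => i.
  by rewrite mxE subr0.
pose S := \sum_i (d i)^-1.
have dS i : (d i)^-1 <= S.
  by rewrite /S (bigD1 i)//= lerDl sumr_ge0// => k _; rewrite invr_ge0 ltW.
have S0 : 0 <= S by apply: sumr_ge0 => k _; rewrite invr_ge0 ltW.
(* Since [(d i)^-1 <= S], every [r / d i] is at most [rho] and less than [e]: the parallelepiped
   lies in [Omega] and in the region where [touch] applies. *)
pose r := Num.min rho (e / 2) / (1 + S).
have r0 : 0 < r by rewrite divr_gt0 ?lt_min ?rho0 ?divr_gt0// ltr_pwDl.
have rd i : r / d i <= Num.min rho (e / 2).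
  rewrite /r mulrAC ler_pdivrMr ?ltr_pwDl// ler_wpM2l//.
    by rewrite le_min ltW//= ltW// divr_gt0.
  by rewrite (le_trans (dS i))// lerDr.
have rd0 i : 0 < r / d i by rewrite divr_gt0.
pose bz : 'rV[R]_n := \row_i (r / d i).
have bzP z : box (- bz) bz z <-> forall i, `|z 0 i| <= r / d i.
  by split=> h i; have := h i; rewrite !mxE ler_norml.
pose E := g @` box (- bz) bz.
have EP x : E x <-> forall i, `|((x - x0) *m N) 0 i| <= r / d i.
  split=> [[z /bzP zb <-] i|/bzP h]; first by rewrite gK.
  by exists ((x - x0) *m N); rewrite ?Kg.
have EO : E `<=` Omega.
  move=> _ [z /bzP zb <-]; apply: geO => i; apply: le_lt_trans (zb i) _.
  by apply: le_lt_trans (rd i) _; rewrite gt_min; apply/orP; right; lra.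
have cE : compact E.
  by apply: continuous_image_compact; [exact: continuous_affine|exact: compact_box].
have Ex0 : E x0.
  by apply/EP => i; rewrite subrr mul0mx mxE normr0 ltW.
(* With these half-sides the linear perturbation is at most [r ^+ 2 / 2] on the parallelepiped, half
   of what the paraboloid gains on its faces. *)
pose bs : 'rV[R]_n := \row_i (d i * r / (2 * n%:R)).
pose P := affine_map N^T p @` box (- bs) bs.
have sub : P `<=` \bigcup_(x in E) subdiff Omega u x.
  move=> _ [eta etab <-]; set xi := affine_map _ _ _.
  have etaP i : `|eta 0 i| <= d i * r / (2 * n%:R).
    by have := etab i; rewrite !mxE ler_norml.
  have xiE y : dot xi y = dot eta (y *m N) + dot p y.
    by rewrite /xi /affine_map dotDl dot_mulmx_tr.
  pose phi x := u x - dot xi x.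
  have [|x1 x1E x1min] := EVT_min_rV (f := phi) (ex_intro _ _ Ex0) cE.
    apply: (continuous_subspaceW EO); apply: within_continuousB => //.
    by apply: continuous_subspaceT => {}x; exact: continuous_dotl.
  have {}x1E : E x1 by rewrite inE in x1E.
  have {}x1min x : E x -> phi x1 <= phi x by move=> Ex; apply: x1min; rewrite inE.
  have O1 := EO _ x1E.
  set z1 := (x1 - x0) *m N.
  have z1b i : `|z1 0 i| <= r / d i by exact: (EP x1).1.
  (* The minimum is not on a face: there [phi] exceeds [phi x0] by at least [r ^+ 2 / 2]. *)
  have z1lt i : `|z1 0 i| < r / d i.
    rewrite lt_neqAle z1b andbT; apply/eqP => z1i.
    have := x1min _ Ex0; rewrite /phi leNgt => /negP; apply.
    have z1rho k : `|z1 0 k| <= rho.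
      by apply: le_trans (z1b k) (le_trans (rd k) _); rewrite ge_min lexx.
    have := touch x1 O1 z1rho; rewrite -/z1 => le1.
    have sq : r ^+ 2 <= \sum_i (d i * z1 0 i) ^+ 2.
      rewrite (bigD1 i)//= -[(d i * _) ^+ 2]real_normK ?num_real// normrM z1i gtr0_norm// mulrC divfK ?gt_eqF//.
      by rewrite lerDl sumr_ge0// => k _; exact: sqr_ge0.
    have ez : dot eta z1 <= r ^+ 2 / 2.
      apply: (@le_trans _ _ (\sum_(k < n) r ^+ 2 / (2 * n%:R))).
        apply: ler_sum => k _; apply: le_trans (ler_norm _) _; rewrite normrM.
        apply: le_trans (ler_pM (normr_ge0 _) (normr_ge0 _) (etaP k) (z1b k)) _.
        have dk := d0 k; rewrite le_eqVlt; apply/orP; left; apply/eqP; field.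
        by rewrite !gt_eqF.
      rewrite sumr_const card_ord -mulr_natr le_eqVlt; apply/orP; left; apply/eqP.
      by field; rewrite gt_eqF.
    have := xiE (x1 - x0); rewrite -/z1 dotBr => xid.
    have r2 : 0 < r ^+ 2 by rewrite exprn_gt0.
    lra.
  exists x1 => // y Oy.
  pose w := (y - x1) *m N.
  pose gap i := r / d i - `|z1 0 i|.
  have gap0 i : 0 < gap i by rewrite subr_gt0.
  pose W := \sum_i `|w 0 i| / gap i.
  have W0 : 0 <= W by apply: sumr_ge0 => i _; rewrite divr_ge0// ltW.
  have wW i : `|w 0 i| <= W * gap i.
    rewrite -ler_pdivrMr// /W (bigD1 i)//= lerDl sumr_ge0// => k _.
    by rewrite divr_ge0// ltW.
  (* So small that moving from [x1] towards [y] by the fraction [s] stays in [E]; by convexity the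
     local minimum is then a minimum over [Omega]. *)
  pose s := (1 + W)^-1.
  have s0 : 0 < s by rewrite invr_gt0 ltr_pwDl.
  have s1 : s <= 1 by rewrite invf_le1 ?ltr_pwDl// lerDl.
  have s01 : 0 <= s <= 1 by rewrite ltW.
  have Es : E (s *: y + (1 - s) *: x1).
    apply/EP => i.
    have -> : (s *: y + (1 - s) *: x1 - x0) *m N = z1 + s *: w.
      rewrite /z1 /w scalemxAl -mulmxDl; congr (_ *m _).
      by apply/rowP => k; rewrite !mxE; ring.
    rewrite mxE [(s *: w) 0 i]mxE; apply: le_trans (ler_normD _ _) _.
    rewrite -lerBrDl normrM gtr0_norm// -/(gap i).
    rewrite mulrC -ler_pdivlMr// /s invrK; apply: le_trans (wW i) _.
    by rewrite mulrC ler_wpM2l// ?lerDr// ltW.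
  have := x1min _ Es; rewrite /phi [dot xi (s *: _ + _)]dotDr !dotZr => le1.
  have := convex_functionE cu Oy O1 s01 => le2.
  have : s * (u x1 - dot xi x1) <= s * (u y - dot xi y) by lra.
  by rewrite ler_pM2l// dotBr; lra.
have bEv : borel_rV E by exact: compact_borel.
have boxle i : (- bz) 0 i <= bz 0 i by rewrite !mxE; have := rd0 i; lra.
have bs0 i : 0 < bs 0 i by rewrite mxE divr_gt0// mulr_gt0.
have boxle' i : (- bs) 0 i <= bs 0 i.
  by have := bs0 i; rewrite [(- bs) 0 i]mxE; lra.
have detT0 : \det N^T != 0 by rewrite det_tr.
have idet0 : \det (invmx N) != 0 by rewrite det_inv invr_eq0.
have detn : 0 < `|\det N| by rewrite normr_gt0.
have : (`|\det N|%:E * (box_vol (- bs) bs)%:E <=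
    Lambda%:E * (`|\det N|^-1%:E * (box_vol (- bz) bz)%:E))%E.
  apply: (@le_trans _ _ (`|\det N^T|%:E * lebesgue_rV (box (- bs) bs))%E).
    by rewrite det_tr lee_wpmul2l ?lee_fin// lebesgue_rV_box_ge.
  apply: le_trans (lebesgue_rV_affine_ge p _ detT0) _.
  apply: le_trans (le_lebesgue_rV sub) _.
  apply: le_trans (MAu bEv EO) _; rewrite lee_wpmul2l ?lee_fin//.
  apply: le_trans (lebesgue_rV_affine_le x0 _ idet0) _.
  rewrite det_inv normfV lee_wpmul2l ?lee_fin//.
  exact: lebesgue_rV_box_le.
rewrite -!EFinM lee_fin.
set Q := box_vol (- bz) bz.
have Q0 : 0 < Q by apply: prodr_gt0 => i _; rewrite !mxE; have := rd0 i; lra.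
have -> : box_vol (- bs) bs = Q * \prod_i (d i ^+ 2 / (2 * n%:R)).
  rewrite /Q /box_vol -big_split/=; apply: eq_bigr => i _; rewrite !mxE.
  by field; rewrite !gt_eqF.
set T := \prod_i _ => le1.
have iQ0 : 0 < `|\det N| / Q by rewrite divr_gt0.
have := ler_wpM2l (ltW iQ0) le1.
rewrite -[\det N ^+ 2]real_normK ?num_real//.
have -> : `|\det N| / Q * (`|\det N| * (Q * T)) = `|\det N| ^+ 2 * T.
  by field; rewrite gt_eqF.
by rewrite (_ : _ * (Lambda * _) = Lambda)//; field; rewrite !gt_eqF.
Qed.

End touching.

(** * The barrier *)

Section barrier_profile.
Context {R : realType}.

(** Convexity of [expR] between [ln y] and 0. *)
Lemma bernoulli_powR (y r : R) : 0 < y -> 0 <= r <= 1 -> y `^ r <= 1 + r * (y - 1).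
Proof.
move=> y0 /andP[r0 r1].
have := convex_expR (Itv01 r0 r1) (ln y) 0.
rewrite !convRE/= expR0 lnK ?posrE// mulr0 addr0.
by rewrite /powR gt_eqF// /unstable.onem; lra.
Qed.

(** For an exponent in [[0, 1]] the power lies between 1 and [1 + x]. *)
Lemma powR_incr_dist (x r : R) : -1 < x -> 0 <= r <= 1 -> `|(1 + x) `^ r - 1| <= `|x|.
Proof.
move=> x1 r01; have y0 : 0 < 1 + x by lra.
have [r0 r1] := andP r01.
have le1 := bernoulli_powR y0 r01; rewrite [1 + x - 1]addrC addKr in le1.
have [x0|x0] := leP 0 x.
  have ge1 : 1 <= (1 + x) `^ r.
    by rewrite -[leLHS](powRr0 (1 + x)) ler_powR// lerDl.
  rewrite !ger0_norm ?subr_ge0//.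
  have : r * x <= 1 * x by rewrite ler_wpM2r.
  lra.
have ge1 : 1 + x <= (1 + x) `^ r.
  rewrite /powR gt_eqF// -[leLHS](@lnK R) ?posrE// ler_expR.
  have : ln (1 + x) <= 0 by rewrite ln_le0//; lra.
  have : 0 <= 1 - r by lra.
  by move=> a b; have := mulr_ge0_le0 a b; lra.
have rx : r * x <= 0 by rewrite mulr_ge0_le0// ltW.
rewrite ler0_norm ?(ltr0_norm x0); lra.
Qed.

(* Used with [s = (1 + x) `^ 3^-1]; the difference of the two sides is divisible by [(s - 1) ^+ 2]. *)
Lemma powR_cube_concave (s : R) : 0 < s -> s ^+ 3 <= 3 / 2 ->
  s ^+ 2 <= 1 + 2 / 3 * (s ^+ 3 - 1) - (s ^+ 3 - 1) ^+ 2 / 147.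
Proof.
move=> s0 s3; have s2 : s <= 2.
  rewrite leNgt; apply/negP => s2.
  have : 2 ^+ 3 <= s ^+ 3 by rewrite ler_pXn2r ?nnegrE// ltW.
  lra.
have q0 : 0 <= (s - 1) ^+ 2 by exact: sqr_ge0.
(* Source of the constant: [s <= 2] bounds this factor of [s ^+ 3 - 1] by 7, and
   [147 = 3 * 7 ^+ 2]. *)
have p7 : (s ^+ 2 + s + 1) ^+ 2 <= 7 ^+ 2.
  have s22 : s ^+ 2 <= 2 ^+ 2 by rewrite ler_pXn2r ?nnegrE// ltW.
  have ss0 := sqr_ge0 s.
  by rewrite ler_pXn2r ?nnegrE//; lra.
have e1 : (s ^+ 3 - 1) ^+ 2 = (s - 1) ^+ 2 * (s ^+ 2 + s + 1) ^+ 2 by ring.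
have e2 : 1 + 2 / 3 * (s ^+ 3 - 1) - s ^+ 2 = (s - 1) ^+ 2 * (2 * s + 1) / 3 by field.
have := ler_wpM2l q0 p7; rewrite -e1 => h1.
have : 0 <= (s - 1) ^+ 2 * s by rewrite mulr_ge0// ltW.
lra.
Qed.

(** Factor the exponent as [2/3] times [3/n]: the first power yields the quadratic gain, and
    Bernoulli for [3/n <= 1] keeps it. *)
Lemma powR_strictly_concave (n : nat) (x : R) : (3 <= n)%N -> `|x| <= 1 / 2 ->
  (1 + x) `^ (2 / n%:R) <= 1 + 2 / n%:R * x - (3 / n%:R / 147) * x ^+ 2.
Proof.
move=> n3; rewrite ler_norml => /andP[x1 x2].
have n0 : 0 < n%:R :> R by rewrite ltr0n; exact: leq_trans n3.
have y0 : 0 < 1 + x by lra.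
pose s := (1 + x) `^ 3^-1.
have s0 : 0 < s by rewrite powR_gt0.
have s3 : s ^+ 3 = 1 + x.
  by rewrite -powR_mulrn ?powR_ge0// -powRrM mulVf// powRr1// ltW.
have -> : (1 + x) `^ (2 / n%:R) = (s ^+ 2) `^ (3 / n%:R).
  rewrite -powR_mulrn ?powR_ge0// -!powRrM; congr (_ `^ _).
  by field; rewrite gt_eqF.
have r01 : 0 <= (3 / n%:R : R) <= 1.
  by rewrite divr_ge0//= ler_pdivrMr// mul1r ler_nat.
apply: le_trans (bernoulli_powR _ r01) _; first by rewrite exprn_gt0.
have := powR_cube_concave s0; rewrite s3 [1 + x - 1]addrC addKr.
have -> : 1 + 2 / n%:R * x - 3 / n%:R / 147 * x ^+ 2 =
    1 + 3 / n%:R * (2 / 3 * x - x ^+ 2 / 147) by field; rewrite gt_eqF.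
move=> h; rewrite lerD2l ler_wpM2l ?divr_ge0//.
have : s ^+ 2 <= 1 + 2 / 3 * x - x ^+ 2 / 147 by apply: h; lra.
lra.
Qed.

(* The quadratic gain comes from [ln (1 + x) = 2 * ln (sqrt (1 + x))]. *)
Lemma xlnx_strictly_convex (x : R) : `|x| <= 1 / 2 ->
  x + x ^+ 2 / 9 <= (1 + x) * ln (1 + x).
Proof.
rewrite ler_norml => /andP[x1 x2]; have y0 : 0 < 1 + x by lra.
pose s := Num.sqrt (1 + x).
have s0 : 0 < s by rewrite sqrtr_gt0.
have s2 : s ^+ 2 = 1 + x by rewrite sqr_sqrtr// ltW.
have s_le2 : s <= 2.
  rewrite leNgt; apply/negP => h.
  have : 2 ^+ 2 <= s ^+ 2 by rewrite ler_pXn2r ?nnegrE// ltW.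
  lra.
have lnE : ln (1 + x) = - (2 * ln s^-1).
  by rewrite -s2 expr2 lnM ?posrE// lnV ?posrE//; ring.
have lns : ln s^-1 <= s^-1 - 1.
  have := @le_ln1Dx R (s^-1 - 1); rewrite subrKC; apply.
  by rewrite -ltrBlDr subrr invr_gt0.
have h1 : s ^+ 2 * ln (1 + x) >= 2 * s ^+ 2 - 2 * s.
  rewrite lnE; have := ler_wpM2l (sqr_ge0 s) lns.
  have -> : s ^+ 2 * (s^-1 - 1) = s - s ^+ 2 by field; rewrite gt_eqF.
  lra.
have xE : x = (s - 1) * (s + 1) by rewrite -subr_sqr expr1n s2; ring.
(* The 9 comes from [x = (s - 1) * (s + 1)] and [s + 1 <= 3]. *)
have h2 : x ^+ 2 / 9 <= (s - 1) ^+ 2.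
  rewrite xE exprMn -mulrA ler_piMr ?sqr_ge0// ler_pdivrMr// mul1r.
  have : (s + 1) ^+ 2 <= 3 ^+ 2 by rewrite ler_pXn2r ?nnegrE//; lra.
  lra.
move: h1; rewrite s2 -/s; have : (s - 1) ^+ 2 = s ^+ 2 - 2 * s + 1 by ring.
lra.
Qed.

Lemma ln2_lt1 : ln 2 < 1 :> R.
Proof.
rewrite -ltr_expR lnK ?posrE//.
by have := @expR_gt1Dx R 1 (oner_neq0 _); rewrite (_ : 1 + 1 = 2).
Qed.

(** Here [c] stands for [|y'|^2], which ranges over [[0, n]]. In order: regularity and the
    normalization behind the constant determinant, the sign of the barrier, its size at [5 * n * m],
    the variation of [f], and a convexity gain in the variable [t] whose factor [4 * n + 1] leaves 1
    after the mixed terms have cost [4 * n]. *)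
Definition is_barrier_profile (n : nat) (f h : R -> R) (C : R) :=
  [/\ forall t, 0 < t ->
        [/\ 0 < f t, {for t, continuous f}, {for t, continuous h} & f t ^+ n = t ^+ 2],
      forall t, 0 < t <= 12 * n%:R -> h t + n%:R * f t <= 0,
      forall m, 0 < m <= 2 -> - h (5 * n%:R * m) <= C * a_under n m,
      forall t s, 0 < t -> `|s| <= t / 2 -> `|f (t + s) - f t| <= f t * (`|s| / t) &
      forall t c, 0 < t -> 0 <= c <= n%:R -> exists q, forall s, `|s| <= t / 2 ->
        h t + f t * c + q * s + (4 * n%:R + 1) * (f t * (s / t) ^+ 2)
          <= h (t + s) + f (t + s) * c].

Lemma barrier_profile_2 : exists f h C, 0 < C /\ is_barrier_profile 2 f h C.
Proof.
(* [A / 9 = 9 = 4 * 2 + 1] is the required gain, and [B] makes [h t + 2 * t] equal to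
   [A * t * (ln t - ln 24)], nonpositive up to [12 * 2]. *)
pose A : R := 81; pose B : R := A * ln 24 + 2.
(* Since [m <= 2], this choice gives [10 * B <= X * (1 - ln m)]. *)
pose X := 10 * B / (1 - ln 2).
have l2 : 0 < 1 - ln 2 :> R by rewrite subr_gt0 ln2_lt1.
have ln24 : 0 <= ln 24 :> R by rewrite ln_ge0// ler1n.
have B0 : 0 < B by rewrite /B /A; lra.
have X0 : 0 < X by rewrite divr_gt0// mulr_gt0.
exists id, (fun t => A * (t * ln t) - B * t), (10 * A + X).
split; first by rewrite addr_gt0//; rewrite /A; lra.
split.
- move=> t t0; split => //.
  apply: (@continuousB R R R (fun t => A * (t * ln t)) (fun t => B * t)).
    apply: (@continuousM R R (fun=> A) (fun t => t * ln t)); first exact: cst_continuous.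
    apply: (@continuousM R R id (@ln R)); first by [].
    exact: continuous_ln.
  by apply: (@continuousM R R (fun=> B) id); first exact: cst_continuous.
- move=> t /andP[t0 t24].
  have lt : ln t <= ln 24 by rewrite ler_ln ?posrE//; lra.
  have -> : A * (t * ln t) - B * t + 2%:R * t = A * t * (ln t - ln 24).
    by rewrite /B; ring.
  by rewrite mulr_ge0_le0 ?subr_le0// mulr_ge0 ?ltW//.
- move=> m /andP[m0 m2]; rewrite /a_under/= m0.
  have -> : 5 * 2 * m = 10 * m by ring.
  rewrite lnM ?posrE//.
  have ln10 : 0 <= ln 10 :> R by rewrite ln_ge0// ler1n.
  have lm : ln m <= ln 2 by rewrite ler_ln ?posrE.
  have Xl : 10 * B <= X * (1 - ln m).
    apply: (@le_trans _ _ (X * (1 - ln 2))); last by apply: ler_wpM2l; [exact: ltW|lra].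
    by rewrite /X divfK ?gt_eqF.
  have h1 := ler_wpM2l (ltW m0) Xl.
  have h2 : 0 <= A * m * ln 10 by rewrite !mulr_ge0// ltW.
  have h3 : 0 <= A * m by rewrite mulr_ge0// ltW.
  lra.
- move=> t s t0 _; rewrite addrC addKr mulrC divfK ?gt_eqF//.
(* The slope is the derivative of [h + c * f] at [t]. *)
- move=> t c t0 _; exists (A * ln t + A - B + c) => s st.
  pose x := s / t.
  have sE : s = t * x by rewrite mulrC divfK ?gt_eqF.
  have x1 : `|x| <= 1 / 2.
    by rewrite normrM normfV (gtr0_norm t0) ler_pdivrMr//; lra.
  have h1 := ler_wpM2l (ltW t0) (xlnx_strictly_convex x1).
  have tE : t + s = t * (1 + x) by rewrite sE; ring.
  have y0 : 0 < 1 + x by move: x1; rewrite ler_norml => /andP[? ?]; lra.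
  rewrite -/x tE lnM ?posrE// sE /A.
  lra.
Qed.

Lemma barrier_profile_ge3 n : (3 <= n)%N ->
  exists f h C, 0 < C /\ is_barrier_profile n f h C.
Proof.
move=> n3; have n0 : 0 < n%:R :> R by rewrite ltr0n; exact: leq_trans n3.
pose a : R := 2 / n%:R; pose c : R := 3 / n%:R / 147.
have c0 : 0 < c by rewrite !divr_gt0.
(* The function in the last clause is [-(B - k) * t ^ a] with [k <= n]; so [(B - k) * c] is at least
   the required gain [4 * n + 1]. *)
pose B := n%:R + (4 * n%:R + 1) / c.
have b0 : 0 < (4 * n%:R + 1) / c by rewrite divr_gt0// addr_gt0// mulr_gt0.
have B0 : 0 < B by rewrite addr_gt0.
have a01 : 0 <= a <= 1.
  by rewrite divr_ge0//= ler_pdivrMr// mul1r ler_nat (leq_trans _ n3).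
have fc t : 0 < t -> {for t, continuous (@powR R ^~ a)}.
  move=> t0.
  have tE : t `^ a = expR (a * ln t) by rewrite /powR gt_eqF.
  have expc : (fun s => expR (a * ln s)) @ t --> t `^ a.
    rewrite tE; apply: (@continuous_comp _ _ _ (fun s => a * ln s) (@expR R)).
      apply: (@continuousM R R (fun=> a) (@ln R)); first exact: cst_continuous.
      exact: continuous_ln.
    exact: continuous_expR.
  apply: cvg_trans expc; apply: near_eq_cvg; near=> s.
  rewrite /powR gt_eqF//; near: s; exact: lt_nbhsr.
have scale t s : 0 < t -> `|s| <= t / 2 ->
    [/\ `|s / t| <= 1 / 2 & (t + s) `^ a = t `^ a * (1 + s / t) `^ a].
  move=> t0 st; have x1 : `|s / t| <= 1 / 2.
    by rewrite normrM normfV (gtr0_norm t0) ler_pdivrMr//; lra.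
  have y0 : 0 < 1 + s / t by move: x1; rewrite ler_norml => /andP[? ?]; lra.
  split=> //; rewrite -powRM ?(ltW t0) ?(ltW y0)//; congr (_ `^ _).
  by field; rewrite gt_eqF.
exists (@powR R ^~ a), (fun t => - (B * t `^ a)), (B * (5 * n%:R) `^ a).
split; first by rewrite mulr_gt0// powR_gt0// mulr_gt0.
split.
- move=> t t0; split; [exact: powR_gt0|exact: fc| |].
    apply: (@continuousN R R R (fun t => B * t `^ a)).
    apply: (@continuousM R R (fun=> B) (@powR R ^~ a)); first exact: cst_continuous.
    exact: fc.
  rewrite -powR_mulrn ?powR_ge0// -powRrM /a divfK ?gt_eqF//.
  by rewrite powR_mulrn// ltW.
- move=> t /andP[t0 _]; rewrite -mulNr -mulrDl mulr_le0_ge0 ?powR_ge0//.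
  by rewrite /B; lra.
- move=> m /andP[m0 _]; rewrite /a_under opprK -/a.
  rewrite (_ : (n == 2)%N = false); last by rewrite gtn_eqF.
  by rewrite -[leRHS]mulrA -powRM ?mulr_ge0// ltW.
- move=> t s t0 st; have [x1 ->] := scale t s t0 st.
  rewrite -[X in _ - X]mulr1 -mulrBr normrM ger0_norm ?powR_ge0//.
  rewrite ler_wpM2l ?powR_ge0//.
  have -> : `|s| / t = `|s / t| by rewrite normrM normfV (gtr0_norm t0).
  by apply: powR_incr_dist => //; move: x1; rewrite ler_norml => /andP[? ?]; lra.
- move=> t k t0 /andP[k0 kn]; exists (- ((B - k) * t `^ a * a / t)) => s st.
  have [x1 ->] := scale t s t0 st; set x := s / t in x1 *.
  have := powR_strictly_concave n3 x1; rewrite -/a -/c => conc.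
  have T0 := powR_ge0 t a; set T := t `^ a in T0 *.
  have Bk : (4 * n%:R + 1) <= (B - k) * c.
    have -> : (B - k) * c = (n%:R - k) * c + (4 * n%:R + 1).
      by rewrite /B; field; rewrite gt_eqF.
    have : 0 <= (n%:R - k) * c by rewrite mulr_ge0 ?subr_ge0// ltW.
    lra.
  have Bk0 : 0 <= (B - k) * T.
    by rewrite mulr_ge0// /B; lra.
  have h1 := ler_wpM2l Bk0 conc.
  have h2 := ler_wpM2r (mulr_ge0 T0 (sqr_ge0 x)) Bk.
  have -> : - ((B - k) * T * a / t) * s = - ((B - k) * T * a * x).
    by rewrite /x; ring.
  lra.
Unshelve. all: by end_near. Qed.

Lemma barrier_profile n : (2 <= n)%N ->
  exists f h C, 0 < C /\ is_barrier_profile n f h C.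
Proof.
rewrite leq_eqVlt => /predU1P[<-|]; first exact: barrier_profile_2.
exact: barrier_profile_ge3.
Qed.

End barrier_profile.

(** * Comparison with the barrier *)

Section closure_facts.
Context {R : realType}.

Lemma closure_le (T : topologicalType) (A : set T) (phi : T -> R) (c : R) :
  continuous phi -> (forall x, A x -> phi x <= c) ->
  forall x, closure A x -> phi x <= c.
Proof.
move=> phic Ac; have cl : closed (phi @^-1` [set r | r <= c]).
  by apply: preimage_closed => [x _|]; [exact: phic|exact: closed_le].
by move=> x Ax; apply: cl; apply: closure_subset Ax.
Qed.

Lemma closure_ge (T : topologicalType) (A : set T) (phi : T -> R) (c : R) :
  continuous phi -> (forall x, A x -> c <= phi x) ->
  forall x, closure A x -> c <= phi x.
Proof.
move=> phic Ac x Ax; rewrite -lerN2.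
apply: (closure_le (phi := fun x => - phi x)) Ax => [y|y Ay]; last by rewrite lerN2 Ac.
by apply: (@continuousN R R T phi); exact: phic.
Qed.

Lemma bounded_closure_compact n (A : set 'rV[R]_n) : bounded_set A -> compact (closure A).
Proof.
move=> [M [Mreal AM]]; pose B := M + 1.
pose b : 'rV[R]_n := const_mx B.
have coordB (x : 'rV[R]_n) i : A x -> `|x 0 i| <= B.
  move=> Ax; have : `|x| <= B by apply: (AM B _ x Ax); rewrite ltrDl.
  by apply: le_trans; rewrite /Num.norm/= mx_normrE; apply: (le_bigmax _ _ (0, i)).
apply: (subclosed_compact _ (@compact_box R n (- b) b)); first exact: closed_closure.
move=> x Ax i; rewrite !mxE; apply/andP; split.
  apply: (closure_ge (phi := fun x : 'rV[R]_n => x 0 i) _ _ Ax) => [|y Ay].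
    exact: coord_continuous.
  by have := coordB y i Ay; rewrite ler_norml => /andP[].
apply: (closure_le (phi := fun x : 'rV[R]_n => x 0 i) _ _ Ax) => [|y Ay].
  exact: coord_continuous.
by have := coordB y i Ay; rewrite ler_norml => /andP[].
Qed.

Lemma closure_boundary n (A : set 'rV[R]_n) x : open A -> closure A x -> ~ A x ->
  boundary A x.
Proof. by move=> oA clx nAx; split => // /interior_subset. Qed.

Lemma open_perturb n (A : set 'rV[R]_n) (x v : 'rV[R]_n) : open A -> A x ->
  exists2 e, 0 < e & forall s, `|s| <= e -> A (x + s *: v).
Proof.
move=> oA Ax; have [e e0 xeA] := (nbhs_rVP x A).1 (open_nbhs_nbhs (conj oA Ax)).
pose S := 1 + \sum_i `|v 0 i|.
have S0 : 0 < S by rewrite ltr_pwDl// sumr_ge0.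
exists (e / 2 / S); first by rewrite !divr_gt0.
move=> s se; apply: xeA => i; rewrite !mxE [x 0 i + _]addrC addrK normrM.
apply: (@le_lt_trans _ _ (e / 2 / S * S)); last by rewrite divfK ?gt_eqF//; lra.
apply: ler_pM => //; rewrite /S (bigD1 i)//=.
have : 0 <= \sum_(k | k != i) `|v 0 k| by exact: sumr_ge0.
lra.
Qed.

End closure_facts.

Section comparison.
Context {R : realType} {n : nat}.
Variables (Omega : set 'rV[R]_n) (u : 'rV[R]_n -> R).
Hypotheses (oOmega : open Omega) (bOmega : bounded_set Omega).
Hypothesis cu : convex_function Omega u.
Hypothesis contu : {within closure Omega, continuous u}.
Hypothesis u0 : forall x, boundary Omega x -> u x = 0.

(* [u + d * x_i0 ^ 2] is strictly convex along the axis [i0], so it has no interior maximum. *)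
Lemma convex_nonpos (i0 : 'I_n) x : Omega x -> u x <= 0.
Proof.
move=> Ox; have cpt := bounded_closure_compact bOmega.
have clx := subset_closure Ox.
pose sq (y : 'rV[R]_n) := y 0 i0 ^+ 2.
have sqc : continuous sq.
  by move=> y; apply: (@continuousM R _ (fun y : 'rV[R]_n => y 0 i0)); exact: coord_continuous.
have [xm _ sqmax] := EVT_max_rV (ex_intro _ _ clx) cpt (continuous_subspaceT sqc).
(* A maximum point of [u + d * sq] must lie on the boundary, where [u] vanishes and [sq] is at most
   [sq xm]; then [d] tends to 0. *)
have key d : 0 < d -> u x <= d * sq xm.
  move=> d0; pose phi y := u y - (- d * sq y).
  have [|z zcl zmax] := EVT_max_rV (f := phi) (ex_intro _ _ clx) cpt.
    apply: within_continuousB => //; apply: continuous_subspaceT => y.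
    by apply: (@continuousM R _ (fun=> - d) sq); [exact: cst_continuous|exact: sqc].
  rewrite inE in zcl.
  have {}zmax y : closure Omega y -> phi y <= phi z by move=> ?; apply: zmax; rewrite inE.
  have [Oz|nOz] := pselect (Omega z); last first.
    have uz : u z = 0 by apply: u0; exact: closure_boundary.
    have h1 := zmax _ clx; have h2 : sq z <= sq xm by apply: sqmax; rewrite inE.
    have h3 := ler_wpM2l (ltW d0) h2.
    have h4 : 0 <= d * sq x by rewrite mulr_ge0 ?sqr_ge0// ltW.
    by move: h1; rewrite /phi uz; lra.
  have [e e0 ze] := open_perturb (delta_mx 0 i0) oOmega Oz.
  pose zp := z + e *: delta_mx 0 i0; pose zm := z + (- e) *: delta_mx 0 i0.
  have Ozp : Omega zp by apply: ze; rewrite gtr0_norm.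
  have Ozm : Omega zm by apply: ze; rewrite normrN gtr0_norm.
  have half : 0 <= (2^-1 : R) <= 1 by apply/andP; split; lra.
  have := convex_functionE cu Ozp Ozm half.
  have -> : 2^-1 *: zp + (1 - 2^-1) *: zm = z.
    by apply/rowP => i; rewrite !mxE; field.
  have := zmax _ (subset_closure Ozp); have := zmax _ (subset_closure Ozm).
  rewrite /phi /sq !mxE !eqxx/= !mulr1 => h1 h2 h3.
  have : 0 < d * e ^+ 2 by rewrite mulr_gt0// exprn_gt0.
  by nra.
have sq0 : 0 <= sq xm by exact: sqr_ge0.
apply/ler_addgt0Pr => e e0; rewrite add0r.
apply: le_trans (key (e / (1 + sq xm)) _) _; first by rewrite divr_gt0// ltr_pwDl.
by rewrite mulrAC ler_pdivrMr ?ltr_pwDl// ler_wpM2l ?ltW// ltrDr.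
Qed.

Definition barrier (f h : R -> R) (j : 'I_n) (y : 'rV[R]_n) : R :=
  h (y 0 j) + f (y 0 j) * \sum_(i | i != j) y 0 i ^+ 2.

Lemma sum_sqr_le (j : 'I_n) (y : 'rV[R]_n) : (forall i, i != j -> `|y 0 i| <= 1) ->
  0 <= \sum_(i | i != j) y 0 i ^+ 2 <= n%:R.
Proof.
move=> y1; apply/andP; split; first by apply: sumr_ge0 => i _; exact: sqr_ge0.
apply: (@le_trans _ _ (\sum_(i < n) 1)); last by rewrite sumr_const card_ord.
rewrite big_mkcond; apply: ler_sum => i _; case: ifP => // ij.
by rewrite -real_normK ?num_real// expr_le1// y1.
Qed.

(** Expanding around [y], the profile gains [(4n+1) f a^2] with [a = |z_j| / y_j], and
    [f (y_j + z_j) >= f / 2] leaves [f |z'|^2 / 2]. The mixed term costs at most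
    [f (4 n a^2 + |z'|^2 / 4)], which leaves [f a^2 + f |z'|^2 / 4]. *)
Lemma barrier_quadratic (f h : R -> R) (C : R) (j : 'I_n) (y : 'rV[R]_n) :
  is_barrier_profile n f h C -> 0 < y 0 j -> (forall i, i != j -> `|y 0 i| <= 1) ->
  exists p, forall z : 'rV[R]_n, `|z 0 j| <= y 0 j / 2 ->
    barrier f h j y + dot p z +
      f (y 0 j) / 4 * ((z 0 j / y 0 j) ^+ 2 + \sum_(i | i != j) z 0 i ^+ 2)
    <= barrier f h j (y + z).
Proof.
move=> [fh _ _ flip hquad] y0 y1; set t := y 0 j in y0 *.
have [ft0 _ _ _] := fh t y0.
have sig := sum_sqr_le y1; set sigma := \sum_(i | i != j) _ in sig.
have [q hq] := hquad t sigma y0 sig.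
exists (\row_i (if i == j then q else 2 * f t * y 0 i)) => z zt.
have dotE : dot (\row_i (if i == j then q else 2 * f t * y 0 i)) z =
    q * z 0 j + 2 * f t * \sum_(i | i != j) y 0 i * z 0 i.
  rewrite /dot (bigD1 j)//= mxE eqxx; congr (_ + _).
  by rewrite mulr_sumr; apply: eq_bigr => i /negbTE ij; rewrite mxE ij; ring.
have sumE : \sum_(i | i != j) (y + z) 0 i ^+ 2 = sigma +
    2 * \sum_(i | i != j) y 0 i * z 0 i + \sum_(i | i != j) z 0 i ^+ 2.
  rewrite /sigma mulr_sumr -!big_split/=; apply: eq_bigr => i _.
  by rewrite mxE; ring.
rewrite /barrier dotE sumE -/t -/sigma mxE -/t.
set S := \sum_(i | i != j) y 0 i * z 0 i; set Z := \sum_(i | i != j) z 0 i ^+ 2.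
set s := z 0 j in zt *.
have Z0 : 0 <= Z by apply: sumr_ge0 => i _; exact: sqr_ge0.
have := hq s zt; have := flip t s y0 zt.
set F := f (t + s); set H := h (t + s); set f0 := f t in ft0 *; set h0 := h t.
move=> lip quad.
pose a := `|s| / t; have a0 : 0 <= a by rewrite divr_ge0// ltW.
have a2 : (s / t) ^+ 2 = a ^+ 2.
  by rewrite /a !exprMn real_normK ?num_real.
have ahalf : a <= 2^-1 by rewrite /a ler_pdivrMr//; lra.
(* AM-GM: [2 a |z_i| <= 4 a^2 + z_i^2 / 4] *)
have Sle : 2 * a * `|S| <= 4 * n%:R * a ^+ 2 + Z / 4.
  apply: (@le_trans _ _ (\sum_(i | i != j) (4 * a ^+ 2 + z 0 i ^+ 2 / 4))).
    apply: le_trans (ler_wpM2l _ (ler_norm_sum _ _ _)) _; first by rewrite mulr_ge0.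
    rewrite mulr_sumr; apply: ler_sum => i ij.
    have yz : `|y 0 i * z 0 i| <= `|z 0 i| by rewrite normrM ler_piMl// y1.
    have := ler_wpM2l (mulr_ge0 (ler0n R 2) a0) yz.
    rewrite -[z 0 i ^+ 2]real_normK ?num_real//.
    have := sqr_ge0 (2 * a - `|z 0 i| / 2); rewrite sqrrB.
    lra.
  rewrite big_split/= -[X in _ + X <= _]mulr_suml lerD2r.
  apply: (@le_trans _ _ (\sum_(i < n) 4 * a ^+ 2)).
    rewrite [leLHS]big_mkcond; apply: ler_sum => i _; case: ifP => // _.
    by rewrite mulr_ge0// sqr_ge0.
  by rewrite sumr_const card_ord -mulr_natr; lra.
have FS : - (f0 * (4 * n%:R * a ^+ 2 + Z / 4)) <= 2 * ((F - f0) * S).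
  rewrite lerNl; apply: le_trans (ler_norm _) _.
  rewrite normrN normrM (ger0_norm (ler0n R 2)) normrM.
  have h1 := ler_wpM2r (normr_ge0 S) lip.
  have h2 := ler_wpM2l (ltW ft0) Sle.
  by rewrite -/a in h1; lra.
have Fhalf : f0 / 2 * Z <= F * Z.
  apply: ler_wpM2r => //; move: lip; rewrite ler_norml => /andP[+ _].
  by have := ler_wpM2l (ltW ft0) ahalf; rewrite -/a; lra.
have fa : 0 <= f0 * a ^+ 2 by rewrite mulr_ge0 ?sqr_ge0// ltW.
move: quad; rewrite a2; lra.
Qed.

Context {Lambda : R}.
Hypotheses (n0 : (0 < n)%N) (Lambda0 : 0 <= Lambda).
Hypothesis MAu : forall A : set 'rV[R]_n, borel_rV A -> A `<=` Omega ->
  (monge_ampere Omega u A <= Lambda%:E * lebesgue_rV A)%E.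
Variables (N : 'M[R]_n) (c : 'rV[R]_n) (j : 'I_n) (m : R).
Hypotheses (N0 : \det N != 0) (m0 : 0 < m).
Hypothesis region_j : forall x, Omega x -> m <= affine_map N c x 0 j <= 12 * n%:R.
Hypothesis region_i : forall x i, Omega x -> i != j -> `|affine_map N c x 0 i| <= 1.

(** The bound on [Lambda] is the negation of what [touching_bound] yields for the paraboloid below
    [k * barrier]. *)
Lemma barrier_le (f h : R -> R) (C k : R) x :
  is_barrier_profile n f h C -> 0 < k -> Lambda < (\det N) ^+ 2 * (k / (8 * n%:R)) ^+ n ->
  Omega x -> k * barrier f h j (affine_map N c x) <= u x.
Proof.
move=> prof k0 Lk Ox; have nR0 : 0 < n%:R :> R by rewrite ltr0n.
have [fh hneg _ _ _] := prof.
have cpt := bounded_closure_compact bOmega.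
have clx := subset_closure Ox.
pose T := affine_map N c.
have Tc i : continuous (fun y => T y 0 i) by exact: continuous_affine_coord.
have clj y : closure Omega y -> m <= T y 0 j <= 12 * n%:R.
  move=> cly; apply/andP; split.
    by apply: (closure_ge (Tc j)) cly => z /region_j/andP[].
  by apply: (closure_le (Tc j)) cly => z /region_j/andP[].
have cli y i : closure Omega y -> i != j -> `|T y 0 i| <= 1.
  move=> cly ij; rewrite ler_norml; apply/andP; split.
    by apply: (closure_ge (Tc i)) cly => z /region_i/(_ ij); rewrite ler_norml => /andP[].
  by apply: (closure_le (Tc i)) cly => z /region_i/(_ ij); rewrite ler_norml => /andP[].
(* The profile is controlled at positive arguments; [0 < m] keeps the whole closure there. *)
have cl0 y : closure Omega y -> 0 < T y 0 j.
  by move=> /clj/andP[my _]; exact: lt_le_trans my.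
have Wneg y : closure Omega y -> barrier f h j (T y) <= 0.
  move=> cly; have [_ t12] := andP (clj y cly).
  have := hneg (T y 0 j); rewrite (cl0 y cly) t12 => /(_ erefl); apply: le_trans.
  rewrite /barrier lerD2l mulrC ler_wpM2r//; first by have [/ltW] := fh _ (cl0 y cly).
  by have /andP[] := @sum_sqr_le j (T y) (fun i ij => cli y i cly ij).
have Wc : {within closure Omega, continuous (fun y => k * barrier f h j (T y))}.
  apply: continuous_in_subspaceT => y; rewrite inE => cly.
  have [_ fc hc _] := fh _ (cl0 y cly).
  apply: (@continuousM R _ (fun=> k) (fun y => barrier f h j (T y))); first exact: cst_continuous.
  apply: (@continuousD R R _ (fun y => h (T y 0 j))
    (fun y => f (T y 0 j) * \sum_(i | i != j) T y 0 i ^+ 2)).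
    by apply: (@continuous_comp _ _ _ (fun y => T y 0 j) h); [exact: Tc|exact: hc].
  apply: (@continuousM R _ (fun y => f (T y 0 j)) (fun y => \sum_(i | i != j) T y 0 i ^+ 2)).
    by apply: (@continuous_comp _ _ _ (fun y => T y 0 j) f); [exact: Tc|exact: fc].
  apply: continuous_sumr => i _.
  by apply: (@continuousM R _ (fun y => T y 0 i) (fun y => T y 0 i)); exact: Tc.
pose psi y := u y - k * barrier f h j (T y).
have [|x0 x0cl x0min] := EVT_min_rV (f := psi) (ex_intro _ _ clx) cpt.
  exact: within_continuousB.
rewrite inE in x0cl.
have {}x0min y : closure Omega y -> psi x0 <= psi y by move=> ?; apply: x0min; rewrite inE.
rewrite -subr_ge0 leNgt; apply/negP => neg.
have {}neg : psi x0 < 0 by exact: le_lt_trans (x0min _ clx) neg.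
have [Ox0|nOx0] := pselect (Omega x0); last first.
  move: neg; rewrite /psi u0; last exact: closure_boundary.
  by rewrite ltNge sub0r oppr_ge0 mulr_ge0_le0 ?Wneg// ltW.
set y0 := T x0; set t := y0 0 j; have t0 : 0 < t by exact: cl0.
have [ft0 _ _ fn] := fh t t0.
have [p hp] := barrier_quadratic prof t0 (fun i ij => cli x0 i x0cl ij).
(* The coefficients [d i] reproduce [k] times the quadratic form of [barrier_quadratic]. *)
pose e := Num.sqrt (k * f t / 4).
have e0 : 0 < e by rewrite sqrtr_gt0 divr_gt0// mulr_gt0.
have e2 : e ^+ 2 = k * f t / 4 by rewrite sqr_sqrtr// ltW// divr_gt0// mulr_gt0.
pose d i := if i == j then e / t else e.
have d0 i : 0 < d i by rewrite /d; case: ifP => // _; rewrite divr_gt0.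
have := @touching_bound R n Omega u Lambda n0 oOmega cu _ Lambda0 MAu N x0
  (k *: p *m N^T) d (t / 2) N0 Ox0 d0 _ _.
rewrite leNgt => /(_ _ _ _)/negP; apply.
- by apply: (continuous_subspaceW (@subset_closure _ Omega)).
- by rewrite divr_gt0.
- move=> y Oy yt; set z := (y - x0) *m N in yt *.
  have Ty : T y = y0 + z.
    by rewrite /T /y0 /T /affine_map /z mulmxBl; apply/rowP => i; rewrite !mxE; ring.
  have := ler_wpM2l (ltW k0) (hp z (yt j)); rewrite -Ty -/t => h1.
  have := x0min y (subset_closure Oy); rewrite /psi -/y0 => h2.
  have -> : dot (k *: p *m N^T) (y - x0) = k * dot p z.
    by rewrite dot_mulmx_tr dotC dotZr dotC.
  have -> : \sum_i (d i * z 0 i) ^+ 2 =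
      k * (f t / 4 * ((z 0 j / t) ^+ 2 + \sum_(i | i != j) z 0 i ^+ 2)).
    rewrite (bigD1 j)//= {1}/d eqxx.
    rewrite (eq_bigr (fun i => e ^+ 2 * z 0 i ^+ 2)); last first.
      by move=> i /negbTE ij; rewrite /d ij exprMn.
    rewrite -mulr_sumr !exprMn e2; ring.
  by rewrite -/y0 -/t in h1; lra.
(* The direction [j] contributes a factor [t ^- 2], which [f t ^+ n = t ^+ 2] cancels. *)
- apply: lt_le_trans Lk _; rewrite le_eqVlt; apply/orP; left; apply/eqP; congr (_ * _).
  have -> : \prod_i (d i ^+ 2 / (2 * n%:R)) =
      \prod_(i < n) ((k / (8 * n%:R) * f t) * (if i == j then (t ^+ 2)^-1 else 1)).
    apply: eq_bigr => i _; rewrite /d; case: ifP => _.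
      by rewrite exprMn e2; field; rewrite !gt_eqF.
    by rewrite e2; field; rewrite gt_eqF.
  rewrite big_split/= prodr_const card_ord -big_mkcond big_pred1_eq [(_ * f t) ^+ n]exprMn fn.
  by field; rewrite !gt_eqF.
Qed.

End comparison.

(** * The estimate in adapted coordinates *)

Section core.
Context {R : realType}.

Lemma cylinder_estimate n : (2 <= n)%N -> exists C : R,
  [/\ 0 < C, forall m : R, 0 < m <= 2 -> 0 <= a_under n m &
      forall (Omega : set 'rV[R]_n) (u : 'rV[R]_n -> R) (Lambda : R)
        (N : 'M[R]_n) (c : 'rV[R]_n) (j : 'I_n) (m : R) (x : 'rV[R]_n),
      open Omega -> bounded_set Omega ->
      {within closure Omega, continuous u} -> convex_function Omega u -> 0 <= Lambda ->
      (forall A : set 'rV[R]_n, borel_rV A -> A `<=` Omega ->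
         (monge_ampere Omega u A <= Lambda%:E * lebesgue_rV A)%E) ->
      (forall x, boundary Omega x -> u x = 0) ->
      \det N != 0 -> 0 < m <= 2 ->
      (forall x, Omega x -> m <= affine_map N c x 0 j <= 12 * n%:R) ->
      (forall x i, Omega x -> i != j -> `|affine_map N c x 0 i| <= 1) ->
      Omega x -> affine_map N c x 0 j = 5 * n%:R * m ->
      `|u x| <= C * `|\det N| `^ (- (2 / n%:R)) * Lambda `^ n%:R^-1 * a_under n m].
Proof.
move=> n2; have [f [h [C0 [C00 prof]]]] := @barrier_profile R n n2.
have n0 : (0 < n)%N by exact: leq_trans n2.
have nR0 : 0 < n%:R :> R by rewrite ltr0n.
have [fh hneg ha _ _] := prof.
(* Read off from the profile: [5 * n * m <= 12 * n], so [- h (5 * n * m)] is nonnegative and bounded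
   by [C0 * a_under n m]. *)
have a0 (m : R) : 0 < m <= 2 -> 0 <= a_under n m.
  move=> m02; have [m0 m2] := andP m02.
  have t0 : 0 < 5 * n%:R * m by rewrite !mulr_gt0//.
  have t12 : 5 * n%:R * m <= 12 * n%:R.
    have := ler_wpM2l (ltW nR0) m2; lra.
  have [ft _ _ _] := fh _ t0.
  have := hneg (5 * n%:R * m); rewrite t0 t12 => /(_ erefl) h0.
  have h1 := ha m m02; have h2 : 0 <= n%:R * f (5 * n%:R * m) by rewrite mulr_ge0// ltW.
  by rewrite -(pmulr_rge0 _ C00); lra.
exists (8 * n%:R * C0); split => //; first by rewrite !mulr_gt0//.
move=> Omega u Lambda N c j m x oO bO contu cu L0 MAu u0 N0 m02 regj regi Ox xj.
have [m0 m2] := andP m02.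
have dN : 0 < `|\det N| by rewrite normr_gt0.
rewrite ler0_norm; last by apply: (convex_nonpos oO bO cu contu u0 j).
set P1 := `|\det N| `^ _; set P2 := Lambda `^ _; pose P := P1 * P2.
have P0 : 0 <= P by rewrite mulr_ge0 ?powR_ge0.
have Pn : P ^+ n = `|\det N| ^- 2 * Lambda.
  rewrite exprMn -!powR_mulrn ?powR_ge0// -!powRrM mulNr divfK ?gt_eqF//.
  by rewrite powRN powR_mulrn// mulVf ?gt_eqF// powRr1.
(* The value [k = 8 * n * P] is borderline for the strict inequality in [barrier_le]; it is
   approached from above, also when [Lambda = 0]. *)
have key e : 0 < e -> - u x <= 8 * n%:R * (P + e) * (C0 * a_under n m).
  move=> e0; have k0 : 0 < 8 * n%:R * (P + e) by rewrite !mulr_gt0// ltr_wpDl.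
  have := barrier_le oO bO cu contu u0 n0 L0 MAu N0 m0 regj regi prof k0 _ Ox.
  have -> : 8 * n%:R * (P + e) / (8 * n%:R) = P + e by field; rewrite gt_eqF.
  move=> /(_ _)/=; rewrite /barrier xj => hk.
  have {}hk : 8 * n%:R * (P + e) * h (5 * n%:R * m) <= u x.
    apply: le_trans (hk _).
      rewrite ler_pM2l// lerDl mulr_ge0//; last by rewrite sumr_ge0// => i _; exact: sqr_ge0.
      by have [/ltW] : 0 < f (5 * n%:R * m) by have [] := fh (5 * n%:R * m); rewrite ?mulr_gt0.
    rewrite -(@ltr_pM2l _ (`|\det N| ^- 2)) ?invr_gt0 ?exprn_gt0// -Pn mulrA.
    rewrite -[\det N ^+ 2]real_normK ?num_real// mulVf ?mul1r ?expf_neq0 ?gt_eqF//.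
    by rewrite ltr_pXn2r ?nnegrE ?ltrDl// addr_ge0// ltW.
  rewrite lerNl; apply: le_trans hk; rewrite -mulrN ler_pM2l// lerNl.
  exact: ha.
rewrite -!mulrA [P1 * _]mulrA -/P.
have Ca : 0 <= 8 * n%:R * (C0 * a_under n m) by rewrite !mulr_ge0 ?a0// ltW.
apply/ler_addgt0Pr => e e0.
set Q := 8 * n%:R * (C0 * a_under n m) in Ca.
apply: le_trans (key (e / (1 + Q)) _) _; first by rewrite divr_gt0// ltr_pwDl.
have -> : 8 * n%:R * (P + e / (1 + Q)) * (C0 * a_under n m) =
    8 * (n%:R * (C0 * (P * a_under n m))) + e / (1 + Q) * Q by rewrite /Q; ring.
by rewrite lerD2l mulrAC ler_pdivrMr ?ltr_pwDl// ler_wpM2l ?ltW// ltrDr.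
Qed.

End core.

Section euclidean_norm.
Context {R : realType} {n : nat}.
Implicit Types x y : 'rV[R]_n.

Lemma enorm_ge0 x : 0 <= enorm x.
Proof. exact: sqrtr_ge0. Qed.

Lemma sqr_enorm x : enorm x ^+ 2 = \sum_i x 0 i ^+ 2.
Proof. by rewrite sqr_sqrtr// sumr_ge0// => i _; exact: sqr_ge0. Qed.

Lemma enorm_le x (r : R) : 0 <= r -> (enorm x <= r) = (\sum_i x 0 i ^+ 2 <= r ^+ 2).
Proof. by move=> r0; rewrite -sqr_enorm ler_pXn2r ?nnegrE ?enorm_ge0. Qed.

Lemma enorm_lt x (r : R) : 0 <= r -> (enorm x < r) = (\sum_i x 0 i ^+ 2 < r ^+ 2).
Proof. by move=> r0; rewrite -sqr_enorm ltr_pXn2r ?nnegrE ?enorm_ge0. Qed.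

Lemma enormZ (a : R) x : enorm (a *: x) = `|a| * enorm x.
Proof.
rewrite /enorm -sqrtr_sqr -sqrtrM ?sqr_ge0// mulr_sumr.
by congr Num.sqrt; apply: eq_bigr => i _; rewrite mxE exprMn.
Qed.

Lemma coord_le_enorm x i : `|x 0 i| <= enorm x.
Proof.
rewrite -(@ler_pXn2r _ 2) ?nnegrE ?enorm_ge0// sqr_enorm real_normK ?num_real//.
by rewrite (bigD1 i)//= lerDl sumr_ge0// => k _; exact: sqr_ge0.
Qed.

Lemma enorm_eq0 x : enorm x = 0 -> x = 0.
Proof.
move=> x0; apply/rowP => i; rewrite mxE; apply/eqP; rewrite -normr_le0.
by apply: le_trans (coord_le_enorm x i) _; rewrite x0.
Qed.

End euclidean_norm.

(** * Adapted coordinates *)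

Section geometry.
Context {R : realType} {n : nat}.
Variable Omega : set 'rV[R]_n.
Hypotheses (oOmega : open Omega) (bOmega : bounded_set Omega).

Lemma boundary_notin z : boundary Omega z -> ~ Omega z.
Proof. by move=> [_ nz] Oz; apply: nz; exact: open_nbhs_nbhs. Qed.

(** Take the supremum of the times spent in [Omega], finite by boundedness. The point reached is a
    limit of points of [Omega], and openness excludes it from [Omega]. *)
Lemma ray_boundary x (v : 'rV[R]_n) : Omega x -> v != 0 ->
  exists2 t, 0 < t & boundary Omega (x + t *: v).
Proof.
move=> Ox v0; pose S := [set t : R | 0 <= t /\ Omega (x + t *: v)].
have S0 : S 0 by split => //; rewrite scale0r addr0.
have [i vi] : exists i, v 0 i != 0.
  apply/existsP; apply: contraNT v0 => /existsPn h; apply/eqP/rowP => i.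
  by rewrite mxE; apply/eqP; have := h i; rewrite negbK.
have [M [Mreal OM]] := bOmega.
have ubS : ubound S ((M + 1 + `|x 0 i|) / `|v 0 i|).
  move=> t [t0 Ot]; rewrite ler_pdivlMr ?normr_gt0//.
  have h1 : `|(x + t *: v) 0 i| <= M + 1.
    have : `|x + t *: v| <= M + 1 by apply: (OM _ _ _ Ot); rewrite ltrDl.
    by apply: le_trans; rewrite [leRHS]/Num.norm/= mx_normrE; apply: (le_bigmax _ _ (0, i)).
  have -> : t * `|v 0 i| = `|(x + t *: v) 0 i - x 0 i|.
    by rewrite !mxE [x 0 i + _]addrC addrK normrM ger0_norm.
  by apply: le_trans (ler_normB _ _) _; rewrite lerD2r h1.
have supS : has_sup S by split; [exists 0|exists ((M + 1 + `|x 0 i|) / `|v 0 i|)].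
have Sle t : S t -> t <= sup S by move=> St; exact: sup_upper_bound.
have [e e0 xe] := open_perturb v oOmega Ox.
exists (sup S).
  apply: (lt_le_trans e0 (Sle _ _)); split; first exact: ltW.
  by apply: xe; rewrite gtr0_norm.
apply: closure_boundary => //.
  move=> B /nbhs_rVP[d d0 Bd].
  pose V := 1 + \sum_i `|v 0 i|.
  have V0 : 0 < V by rewrite ltr_pwDl// sumr_ge0.
  have [t [t0 Ot] lt] := sup_adherent (divr_gt0 d0 V0) supS.
  have tle := Sle t (conj t0 Ot).
  exists (x + t *: v); split => //; apply: Bd => k.
  rewrite !mxE opprD addrACA subrr add0r -mulrBl normrM.
  apply: (@le_lt_trans _ _ (`|t - sup S| * V)).
    rewrite ler_wpM2l// /V (bigD1 k)//=.
    have : 0 <= \sum_(l | l != k) `|v 0 l| by apply: sumr_ge0.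
    lra.
  rewrite -ltr_pdivlMr// ltr_norml; apply/andP; split; first lra.
  by have := divr_gt0 d0 V0; lra.
move=> Os; have [d d0 sd] := open_perturb v oOmega Os.
have : S (sup S + d).
  split; first by rewrite addr_ge0 ?ltW// (lt_le_trans e0)// Sle//; split;
    [exact: ltW|apply: xe; rewrite gtr0_norm].
  by rewrite scalerDl addrA; apply: sd; rewrite gtr0_norm.
by move=> /Sle; rewrite gerDl leNgt d0.
Qed.

Lemma dist_set_le x z : boundary Omega z -> dist_set x (boundary Omega) <= enorm (x - z).
Proof.
move=> bz; apply: ge_inf; last by exists z.
by exists 0 => _ [y _ <-]; exact: enorm_ge0.
Qed.

Lemma dist_set_gt0 x : Omega x -> boundary Omega !=set0 ->
  0 < dist_set x (boundary Omega).
Proof.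
move=> Ox [z bz].
have [e e0 xe] := (nbhs_rVP x Omega).1 (open_nbhs_nbhs (conj oOmega Ox)).
apply: lt_le_trans e0 _; apply: lb_le_inf; first by exists (enorm (x - z)), z.
move=> _ [y by_ <-]; rewrite leNgt; apply/negP => lt.
apply: (boundary_notin by_); apply: xe => i; apply: le_lt_trans lt.
by rewrite distrC; have := coord_le_enorm (x - y) i; rewrite !mxE.
Qed.

Lemma dist_set_adherent x : Omega x -> boundary Omega !=set0 ->
  exists2 z, boundary Omega z & enorm (x - z) < 2 * dist_set x (boundary Omega).
Proof.
move=> Ox bne; have d0 := dist_set_gt0 Ox bne.
have hinf : has_inf [set enorm (x - y) | y in boundary Omega].
  split; first by case: bne => z bz; exists (enorm (x - z)), z.
  by exists 0 => _ [y _ <-]; exact: enorm_ge0.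
have [_ [z bz <-] lt] := inf_adherent d0 hinf.
by exists z => //; move: lt; rewrite -/(dist_set x _); lra.
Qed.

Hypothesis cOmega : convex_set Omega.

(** A point [w] of [Omega] near the reflection has its own reflection [2 *: z - w] near [x], hence
    in [Omega]; their midpoint [z] would then be in [Omega]. *)
Lemma reflection_notin_closure x z : Omega x -> boundary Omega z ->
  ~ closure Omega (2 *: z - x).
Proof.
move=> Ox bz clw.
have [e e0 xe] := (nbhs_rVP x Omega).1 (open_nbhs_nbhs (conj oOmega Ox)).
have nb : nbhs (2 *: z - x) [set y : 'rV[R]_n | forall i, `|y 0 i - (2 *: z - x) 0 i| < e].
  by apply/nbhs_rVP; exists e.
have [w [Ow wd]] := clw _ nb.
have Ox' : Omega (2 *: z - w).
  apply: xe => i; have := wd i; rewrite !mxE distrC.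
  by congr (`|_| < _); ring.
have half : 0 <= (2^-1 : R) <= 1 by apply/andP; split; lra.
apply: (boundary_notin bz); have := convex_setE cOmega Ow Ox' half.
by congr Omega; apply/rowP => i; rewrite !mxE; field.
Qed.

(* [nu] is [L (q - w)] for the point [q] of the closure that minimizes [|L (q - w)|], [L x = x *m M]. *)
Lemma separating_functional (M : 'M[R]_n) (w : 'rV[R]_n) : \det M != 0 ->
  Omega !=set0 -> ~ closure Omega w ->
  exists2 nu : 'rV[R]_n, nu != 0 & forall y, Omega y -> 0 <= dot nu ((y - w) *m M).
Proof.
move=> M0 [x Ox] nw.
have uM : M \in unitmx by rewrite unitmxE unitfE.
pose L y := (y - w) *m M.
have Lc i : continuous (fun y => L y 0 i).
  move=> y; rewrite (_ : (fun _ => _) = (fun y => affine_map M (- (w *m M)) y 0 i)).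
    exact: continuous_affine_coord.
  by apply/funext => z; rewrite /L /affine_map mulmxBl.
pose g y := \sum_i L y 0 i ^+ 2.
have gc : continuous g.
  move=> y; apply: continuous_sumr => i _.
  by apply: (@continuousM R _ (fun y => L y 0 i) (fun y => L y 0 i)); exact: Lc.
have [q qcl qmin] := EVT_min_rV (ex_intro _ _ (subset_closure Ox))
  (bounded_closure_compact bOmega) (continuous_subspaceT gc).
rewrite inE in qcl.
exists (L q).
  apply/eqP => Lq; apply: nw; suff <- : q = w by [].
  by apply/eqP; rewrite -subr_eq0; apply/eqP; rewrite -(mulmxK uM (q - w)) -/(L q) Lq mul0mx.
move=> y Oy; rewrite leNgt; apply/negP => neg.
pose v := (y - q) *m M; pose A := dot (L q) v; pose Q := \sum_i v 0 i ^+ 2.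
have Q0 : 0 <= Q by apply: sumr_ge0 => i _; exact: sqr_ge0.
have Aneg : A < 0.
  have : dot (L q) (L y) = dot (L q) (L q) + A.
    by rewrite /A -dotDr /v /L -mulmxDl; congr (dot _ (_ *m _));
      apply/rowP => i; rewrite !mxE; ring.
  have : 0 <= dot (L q) (L q).
    by apply: sumr_ge0 => i _; rewrite -expr2 sqr_ge0.
  by rewrite -/(L y) in neg; lra.
have key s : 0 <= s <= 1 -> 0 <= 2 * s * A + s ^+ 2 * Q.
  move=> s01.
  have : g q <= g (s *: y + (1 - s) *: q).
    (* As [q] is only in the closure, the inequality is proved with [q] replaced by points of
       [Omega] and passes to the limit. *)
    pose psi p := s *: y + (1 - s) *: p.
    have psic : continuous psi.
      apply: continuous_rV => i p.
      rewrite (_ : (fun _ => _) = (fun p => (p *m (1 - s)%:M + s *: y) 0 i)).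
        exact: continuous_affine_coord.
      by apply/funext => p'; rewrite /psi mul_mx_scalar !mxE addrC.
    apply: (closure_ge (phi := fun p => g (psi p)) _ _ qcl) => [p|p Op].
      by apply: (@continuous_comp _ _ _ psi g); [exact: psic|exact: gc].
    by apply: qmin; rewrite inE; apply: subset_closure; exact: convex_setE.
  have -> : g (s *: y + (1 - s) *: q) = g q + (2 * s * A + s ^+ 2 * Q).
    have Ls : L (s *: y + (1 - s) *: q) = L q + s *: v.
      rewrite /L /v scalemxAl -mulmxDl; congr (_ *m _).
      by apply/rowP => i; rewrite !mxE; ring.
    rewrite /g Ls /A /Q /dot !mulr_sumr -!big_split/=.
    by apply: eq_bigr => i _; rewrite mxE [(s *: v) 0 i]mxE; ring.
  by rewrite lerDl.
(* The step [s = - A / D] satisfies [s * Q <= - A], so the first-order term wins and the first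
   variation is negative. *)
pose D := Q - A + 1; have D0 : 0 < D by rewrite /D; lra.
have s0 : 0 < - A / D by rewrite divr_gt0 ?oppr_gt0.
have s01 : 0 <= - A / D <= 1 by rewrite (ltW s0)/= ler_pdivrMr// /D; lra.
have := key _ s01; set s := - A / D in s0 *.
have -> : 2 * s * A + s ^+ 2 * Q = s * (2 * A + s * Q) by ring.
rewrite (pmulr_rge0 _ s0) leNgt => /negP; apply.
have : s * Q <= - A.
  rewrite /s mulrAC ler_pdivrMr// ler_wpM2l//; first by lra.
  by rewrite /D; lra.
lra.
Qed.

End geometry.

Section linear_data.
Context {R : realType} {n : nat}.
Variables (Omega : set 'rV[R]_n) (M : 'M[R]_n) (b : 'rV[R]_n).
Hypotheses (oOmega : open Omega) (bOmega : bounded_set Omega) (n0 : (0 < n)%N).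
Hypothesis (M0 : \det M != 0).
Hypothesis Mball : affine_map M b @` Omega `<=` eball 1.

Lemma closure_image_le1 z : closure Omega z -> \sum_i affine_map M b z 0 i ^+ 2 <= 1.
Proof.
apply: (closure_le (phi := fun z => \sum_i affine_map M b z 0 i ^+ 2)) => [y|y Oy].
  apply: continuous_sumr => i _.
  apply: (@continuousM R _ (fun y => affine_map M b y 0 i) (fun y => affine_map M b y 0 i));
    exact: continuous_affine_coord.
have : enorm (affine_map M b y) < 1 by apply: Mball; exists y.
by rewrite -sqr_enorm => /ltW lt; rewrite expr_le1// enorm_ge0.
Qed.

(* The bound 2 is the diameter of the unit ball, which contains the image of [Omega]. *)
Lemma spectral_bound x (v : 'rV[R]_n) : Omega x -> enorm v <= 1 ->
  dist_set x (boundary Omega) * enorm (v *m M) <= 2.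
Proof.
move=> Ox v1; have [->|v0] := eqVneq v 0.
  rewrite mul0mx (_ : enorm 0 = 0) ?mulr0//.
  by rewrite /enorm big1 ?sqrtr0// => i _; rewrite mxE expr0n.
(* The ray along [v] leaves [Omega] at a time [t] at least the distance, and [t *: (v *m M)] is a
   difference of two points of the closed unit ball. *)
have [t t0 bt] := ray_boundary oOmega bOmega Ox v0.
have dt : dist_set x (boundary Omega) <= t.
  apply: le_trans (dist_set_le _ bt) _.
  rewrite (_ : x - _ = (- t) *: v); last by apply/rowP => i; rewrite !mxE; ring.
  by rewrite enormZ normrN gtr0_norm// ler_piMr// ltW.
apply: le_trans (ler_wpM2r (enorm_ge0 _) dt) _.
rewrite -[t in leLHS](gtr0_norm t0) -enormZ enorm_le//.
have h1 := closure_image_le1 (proj1 bt).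
have h2 := closure_image_le1 (subset_closure Ox).
apply: (@le_trans _ _ (\sum_i (2 * affine_map M b (x + t *: v) 0 i ^+ 2 +
    2 * affine_map M b x 0 i ^+ 2))); last first.
  by rewrite big_split/= -!mulr_sumr; lra.
apply: ler_sum => i _; set p := affine_map M b x 0 i.
have -> : affine_map M b (x + t *: v) 0 i = p + (t *: (v *m M)) 0 i.
  by rewrite /p /affine_map mulmxDl -scalemxAl [LHS]mxE [X in X + _]mxE [in RHS]mxE; ring.
by have := sqr_ge0 (2 * p + (t *: (v *m M)) 0 i); nra.
Qed.

(** The supremum defining [spectral_norm] is over a set bounded by [2 / dist], by
    [spectral_bound]. *)
Lemma enorm_mulmx_le x (v : 'rV[R]_n) : Omega x -> boundary Omega !=set0 ->
  enorm (v *m M) <= spectral_norm M * enorm v.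
Proof.
move=> Ox bne; have d0 := dist_set_gt0 oOmega Ox bne.
have [->|v0] := eqVneq v 0.
  rewrite mul0mx (_ : enorm 0 = 0) ?mulr0//.
  by rewrite /enorm big1 ?sqrtr0// => i _; rewrite mxE expr0n.
have ev : 0 < enorm v.
  by rewrite lt_neqAle enorm_ge0 andbT eq_sym; apply: contra_neq v0; exact: enorm_eq0.
rewrite -ler_pdivrMr// mulrC -[(enorm v)^-1]gtr0_norm ?invr_gt0// -enormZ scalemxAl.
apply: sup_ubound.
  exists (2 / dist_set x (boundary Omega)) => _ [y y1 <-].
  by rewrite ler_pdivlMr// mulrC; exact: spectral_bound.
exists ((enorm v)^-1 *: v) => //=.
by rewrite enormZ gtr0_norm ?invr_gt0// mulVf// gt_eqF.
Qed.

Lemma spectral_dist_bounds x : Omega x -> boundary Omega !=set0 ->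
  0 < spectral_norm M * dist_set x (boundary Omega) <= 2.
Proof.
move=> Ox bne; have d0 := dist_set_gt0 oOmega Ox bne.
pose e : 'rV[R]_n := delta_mx 0 (Ordinal n0).
have e1 : enorm e = 1.
  rewrite /enorm (bigD1 (Ordinal n0))//= big1 => [|i /negbTE i0].
    by rewrite mxE !eqxx addr0 expr1n sqrtr1.
  by rewrite mxE i0 andbF expr0n.
have eM : 0 < enorm (e *m M).
  rewrite lt_neqAle enorm_ge0 andbT eq_sym; apply/eqP => /enorm_eq0 eM0.
  have uM : M \in unitmx by rewrite unitmxE unitfE.
  have := mulmxK uM e; rewrite eM0 mul0mx => e0.
  by move: e1; rewrite -e0 /enorm big1 ?sqrtr0 => [/eqP|i _];
    [rewrite eq_sym oner_eq0|rewrite mxE expr0n].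
apply/andP; split.
  rewrite mulr_gt0//; apply: lt_le_trans eM _.
  by have := enorm_mulmx_le e Ox bne; rewrite e1 mulr1.
rewrite -ler_pdivlMr//; apply: ge_sup; first by exists (enorm (e *m M)), e => //=; rewrite e1.
by move=> _ [y y1 <-]; rewrite ler_pdivlMr// mulrC; exact: spectral_bound.
Qed.

Hypothesis cOmega : convex_set Omega.

(* Replacing the coordinate [j] in which the functional is largest, instead of rotating,
   keeps the determinant up to sign. *)
Lemma adapted_coordinates x : Omega x -> boundary Omega !=set0 ->
  let m := spectral_norm M * dist_set x (boundary Omega) in
  exists N c j, [/\ `|\det N| = `|\det M|,
    forall y, Omega y -> m <= affine_map N c y 0 j <= 12 * n%:R,
    forall y i, Omega y -> i != j -> `|affine_map N c y 0 i| <= 1 &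
    affine_map N c x 0 j = 5 * n%:R * m].
Proof.
move=> Ox bne m; have [m0 m2] := andP (spectral_dist_bounds Ox bne).
rewrite -/m in m0 m2.
have nR1 : 1 <= n%:R :> R by rewrite ler1n.
have [z bz xz] := dist_set_adherent oOmega Ox bne.
pose w := 2 *: z - x.
have [nu nu0 sep] := separating_functional bOmega cOmega M0 (ex_intro _ _ Ox)
  (reflection_notin_closure oOmega cOmega Ox bz).
pose j := [arg max_(i > Ordinal n0) `|nu 0 i|]%O.
have jmax i : `|nu 0 i| <= `|nu 0 j|.
  by rewrite /j; case: Order.TotalTheory.arg_maxP => //= k _ h; exact: h.
have nuj : 0 < `|nu 0 j|.
  rewrite lt_neqAle normr_ge0 andbT eq_sym; apply/eqP => nj.
  move/eqP: nu0; apply; apply/rowP => i; rewrite mxE; apply/eqP.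
  by rewrite -normr_le0 -nj.
(* Normalized so that [|mu 0 j| = 1], which makes the determinant of [T] equal to 1 in absolute
   value. *)
pose mu := `|nu 0 j|^-1 *: nu.
have muj : `|mu 0 j| = 1 by rewrite mxE normrM normfV normr_id mulVf ?gt_eqF.
have mu1 i : `|mu 0 i| <= 1.
  by rewrite mxE normrM normfV normr_id mulrC ler_pdivrMr// mul1r.
have dotmu p : `|dot mu p| <= \sum_i `|p 0 i|.
  apply: le_trans (ler_norm_sum _ _ _) _; apply: ler_sum => i _.
  by rewrite normrM ler_piMl.
(* [x - w] is twice [x - z], hence shorter than 4 times the distance. *)
have wbound : `|dot mu ((x - w) *m M)| <= 4 * n%:R * m.
  apply: le_trans (dotmu _) _.
  apply: (@le_trans _ _ (\sum_(i < n) spectral_norm M * (4 * dist_set x (boundary Omega)))).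
    apply: ler_sum => i _; apply: le_trans (coord_le_enorm _ _) _.
    apply: le_trans (enorm_mulmx_le _ Ox bne) _.
    have s0 : 0 < spectral_norm M.
      by rewrite -(pmulr_lgt0 _ (dist_set_gt0 oOmega Ox bne)).
    rewrite ler_pM2l// (_ : x - w = 2 *: (x - z)); last first.
      by apply/rowP => k; rewrite !mxE; ring.
    by rewrite enormZ gtr0_norm//; lra.
  by rewrite sumr_const card_ord -mulr_natr /m; lra.
pose L := affine_map M b.
have Lle y i : Omega y -> `|L y 0 i| <= 1.
  move=> Oy; apply: le_trans (coord_le_enorm _ _) _; apply/ltW.
  by apply: Mball; exists y.
pose T := (row_subst j mu)^T.
have mulT (y : 'rV[R]_n) i : (y *m T) 0 i = if i == j then dot mu y else y 0 i.
  rewrite mxE; case: eqVneq => [->|ij].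
    by apply: eq_bigr => k _; rewrite !mxE eqxx mulrC.
  rewrite (bigD1 i)//= !mxE (negbTE ij) eqxx mulr1 big1 ?addr0// => k ki.
  by rewrite !mxE (negbTE ij) eq_sym (negbTE ki) mulr0.
(* The shift puts [x] at height [5 * n * m]. The functional is nonnegative relative to [w], so
   heights stay above [5 * n * m - 4 * n * m >= m]; from above they are at most [2 * n + 10 * n]. *)
pose c := b *m T + (5 * n%:R * m - dot mu (L x)) *: delta_mx 0 j.
have TE y i : affine_map (M *m T) c y 0 i =
    if i == j then dot mu ((y - x) *m M) + 5 * n%:R * m else L y 0 i.
  have -> : affine_map (M *m T) c y =
      L y *m T + (5 * n%:R * m - dot mu (L x)) *: delta_mx 0 j.
    by rewrite /affine_map /c addrA mulmxA -mulmxDl.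
  rewrite mxE mulT !mxE eqxx/=; case: eqVneq => [_|_]; last by rewrite mulr0 addr0.
  have -> : (y - x) *m M = L y - L x.
    by rewrite /L /affine_map opprD addrACA subrr addr0 mulmxBl.
  by rewrite dotBr mulr1; ring.
exists (M *m T), c, j; split.
- by rewrite det_mulmx det_tr det_row_subst normrM muj mulr1.
- move=> y Oy; rewrite TE eqxx; apply/andP; split.
    have : 0 <= dot mu ((y - w) *m M).
      by rewrite /mu dotC dotZr dotC mulr_ge0 ?sep// invr_ge0.
    have -> : (y - w) *m M = (y - x) *m M + (x - w) *m M.
      by rewrite -mulmxDl subrKA.
    rewrite dotDr => h1; move: wbound; rewrite ler_norml => /andP[_ h2].
    have := ler_wpM2r (ltW m0) nR1; lra.
  have : `|dot mu ((y - x) *m M)| <= 2 * n%:R.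
    apply: le_trans (dotmu _) _.
    apply: (@le_trans _ _ (\sum_(i < n) 2)); last first.
      by rewrite sumr_const card_ord -[leLHS]mulr_natr.
    apply: ler_sum => i _.
    have -> : (y - x) *m M = L y - L x.
      by rewrite /L /affine_map opprD addrACA subrr addr0 mulmxBl.
    rewrite mxE [(- L x) 0 i]mxE; apply: le_trans (ler_normB _ _) _.
    by have := Lle y i Oy; have := Lle x i Ox; lra.
  rewrite ler_norml => /andP[_ h1].
  have := ler_wpM2l (ler0n R n) m2; lra.
- by move=> y i Oy ij; rewrite TE (negbTE ij) Lle.
- by rewrite TE eqxx subrr mul0mx dotr0 add0r.
Qed.

End linear_data.

(** * The cylinder as an admissible domain *)

Section cylinder_facts.
Context {R : realType} {n : nat} (n2 : (2 <= n)%N).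
Let j0 : 'I_n := Ordinal (ltnW n2).
Implicit Types x y : 'rV[R]_n.

Lemma sum_tail x :
  \sum_i tail_coords n2 x 0 i ^+ 2 = \sum_(i | i != j0) x 0 i ^+ 2.
Proof.
apply: (@addrI _ (x 0 j0 ^+ 2)).
have <- : \sum_i x 0 i ^+ 2 = x 0 j0 ^+ 2 + \sum_(i | i != j0) x 0 i ^+ 2.
  by rewrite (bigD1 j0).
rewrite (@bigD1_ord _ _ _ _ j0)//=; congr (_ + _).
by apply: eq_bigr => i _; rewrite mxE.
Qed.

Lemma enorm_tail_lt1 x :
  (enorm (tail_coords n2 x) < 1) = (\sum_(i | i != j0) x 0 i ^+ 2 < 1).
Proof. by rewrite enorm_lt// expr1n sum_tail. Qed.

Lemma enorm_tail_le1 x :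
  (enorm (tail_coords n2 x) <= 1) = (\sum_(i | i != j0) x 0 i ^+ 2 <= 1).
Proof. by rewrite enorm_le// expr1n sum_tail. Qed.

Lemma cylinderE : cylinder n2 =
  [set x : 'rV[R]_n | 0 < x 0 j0 < 2 /\ \sum_(i | i != j0) x 0 i ^+ 2 < 1].
Proof.
by apply/seteqP; split => x [x2 xt]; split => //; move: xt;
  rewrite /eball/= enorm_tail_lt1.
Qed.

Lemma cylinder_coord_le1 x i : cylinder n2 x -> i != j0 -> `|x 0 i| <= 1.
Proof.
rewrite cylinderE => -[_ xt] ij.
rewrite -(@expr_le1 _ 2)// real_normK ?num_real//; apply: le_trans (ltW xt).
by rewrite (bigD1 i)//= lerDl sumr_ge0// => k _; exact: sqr_ge0.
Qed.

Lemma open_cylinder : open (cylinder n2 : set 'rV[R]_n).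
Proof.
have cj : continuous (fun x : 'rV[R]_n => x 0 j0) by exact: coord_continuous.
have cs : continuous (fun x : 'rV[R]_n => \sum_(i | i != j0) x 0 i ^+ 2).
  move=> x; apply: continuous_sumr => i _.
  by apply: (@continuousM R _ (fun x : 'rV[R]_n => x 0 i) (fun x : 'rV[R]_n => x 0 i));
    exact: coord_continuous.
rewrite cylinderE (_ : [set _ | _] = ((fun x : 'rV[R]_n => x 0 j0) @^-1` [set t | 0 < t] `&`
    (fun x : 'rV[R]_n => x 0 j0) @^-1` [set t | t < 2]) `&`
    (fun x : 'rV[R]_n => \sum_(i | i != j0) x 0 i ^+ 2) @^-1` [set t | t < 1]).
  apply: openI; first apply: openI.
  - by apply: open_comp => [x _|]; [exact: cj|exact: open_gt].
  - by apply: open_comp => [x _|]; [exact: cj|exact: open_lt].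
  - by apply: open_comp => [x _|]; [exact: cs|exact: open_lt].
by apply/seteqP; split => x /= => [[/andP[? ?] ?]|[[-> ->] ?]].
Qed.

Lemma bounded_cylinder : bounded_set (cylinder n2 : set 'rV[R]_n).
Proof.
exists 2; split => [|M M2 x cx]; first exact: num_real.
rewrite /Num.norm/= mx_normrE; apply: bigmax_le => [|[k i] _] /=.
  by apply: ltW; exact: lt_trans M2.
rewrite ord1; apply/ltW; apply: le_lt_trans M2.
have [->|ij] := eqVneq i j0; last first.
  by apply: le_trans (cylinder_coord_le1 cx ij) _; lra.
by move: cx; rewrite cylinderE => -[/andP[? ?] _]; rewrite gtr0_norm// ltW.
Qed.

(** Moving [x] slightly towards the interior point [(1, 0)] enters the cylinder, so [x] is in the
    closure. *)
Lemma cylinder_boundary x : 0 <= x 0 j0 <= 1 ->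
  \sum_(i | i != j0) x 0 i ^+ 2 <= 1 -> ~ cylinder n2 x -> boundary (cylinder n2) x.
Proof.
move=> /andP[xj0 xj1] xt nx; apply: (closure_boundary open_cylinder) => //.
move=> B nB.
have [e e0 xe] := open_perturb (delta_mx 0 j0 - x) (@open_interior _ B) nB.
pose s := Num.min e 2^-1.
have s0 : 0 < s by rewrite lt_min e0 invr_gt0 ltr0n.
have s2 : s <= 2^-1 by rewrite ge_min lexx orbT.
exists (x + s *: (delta_mx 0 j0 - x)); split; last first.
  by apply: interior_subset; apply: xe; rewrite gtr0_norm// ge_min lexx.
rewrite cylinderE; split.
  rewrite !mxE !eqxx/=; have := mulr_ge0 (ltW s0) xj0.
  have := ler_wpM2r xj0 s2.
  by move=> h1 h2; apply/andP; split; lra.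
have -> : \sum_(i | i != j0) (x + s *: (delta_mx 0 j0 - x)) 0 i ^+ 2 =
    (1 - s) ^+ 2 * \sum_(i | i != j0) x 0 i ^+ 2.
  rewrite mulr_sumr; apply: eq_bigr => i /negbTE ij.
  by rewrite !mxE ij andbF/=; ring.
apply: (@le_lt_trans _ _ ((1 - s) ^+ 2)); first by rewrite ler_piMr ?sqr_ge0.
by rewrite expr_lt1//; lra.
Qed.

Lemma affine_map1 (c x : 'rV[R]_n) : affine_map 1%:M c x = x + c.
Proof. by rewrite /affine_map mulmx1. Qed.

End cylinder_facts.

Theorem lemma16 (R : realType) (n : nat) (n2 : (2 <= n)%N) :
  exists C : R,
    [/\ 0 < C,
        forall v2 : 'rV[R]_n -> R, is_cylinder_solution n2 v2 ->
          forall x : 'rV[R]_n,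
            0 <= fst_coord n2 x <= 1 -> enorm (tail_coords n2 x) <= 1 ->
            `|v2 x| <= C * a_under n (fst_coord n2 x) &
        forall (Omega : set 'rV[R]_n) (M : 'M[R]_n) (b : 'rV[R]_n)
               (Lambda : R) (u : 'rV[R]_n -> R),
          open Omega -> bounded_set Omega -> convex_set Omega ->
          bijective (affine_map M b) ->
          affine_map M b @` Omega `<=` eball 1 ->
          0 <= Lambda ->
          {within closure Omega, continuous u} ->
          convex_function Omega u ->
          (forall A : set 'rV[R]_n, borel_rV A -> A `<=` Omega ->
             (monge_ampere Omega u A <= Lambda%:E * lebesgue_rV A)%E) ->
          (forall x, boundary Omega x -> u x = 0) ->
          forall x, Omega x ->
            `|u x| <= C * `|\det M| `^ (- (2 / n%:R)) * Lambda `^ n%:R^-1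
                      * a_under n (spectral_norm M * dist_set x (boundary Omega))].
Proof.
have [C [C0 a0 est]] := @cylinder_estimate R n n2.
have n0 : (0 < n)%N by exact: ltnW n2.
have nR2 : 2 <= n%:R :> R by rewrite ler_nat.
exists C; split => //.
- move=> v [vc vconv vMA vbd] x x01 xt; rewrite /fst_coord in x01 *.
  set j := Ordinal (ltnW n2) in x01 *.
  rewrite enorm_tail_le1 -/j in xt.
  have [cx|ncx] := pselect (cylinder n2 x); last first.
    rewrite vbd ?normr0; last exact: cylinder_boundary.
    rewrite mulr_ge0//; first exact: ltW.
    (* At 0 the nonnegativity of [a_under] is checked directly. *)
    have [<-|xj0] := eqVneq 0 (x 0 j).
      rewrite /a_under ltxx; case: ifP => // _; exact: powR_ge0.
    by apply: a0; move: x01; rewrite le_eqVlt (negbTE xj0)/= => /andP[-> h]; lra.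
  have t0 : 0 < x 0 j by move: cx => [/andP[]].
  have t1 : x 0 j <= 1 by have /andP[] := x01.
  (* The cylinder is in adapted form already, with identity matrix and [m = x_1]; only the shift
     that puts [x] at height [5 * n * x_1] is required. *)
  pose c : 'rV[R]_n := ((5 * n%:R - 1) * x 0 j) *: delta_mx 0 j.
  have Ej y : affine_map 1%:M c y 0 j = y 0 j + (5 * n%:R - 1) * x 0 j.
    by rewrite affine_map1 !mxE !eqxx mulr1.
  have := est (cylinder n2) v 1 1%:M c j (x 0 j) x (@open_cylinder R n n2)
    (@bounded_cylinder R n n2) vc vconv ler01 _ vbd _ _ _ _ cx _.
  rewrite det1 normr1 !powR1 !mulr1; apply.
  + by move=> A bA Acyl; rewrite vMA// mul1e.
  + exact: oner_neq0.
  + by rewrite t0/=; lra.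
  + move=> y [/andP[y0 y2] _]; rewrite Ej; rewrite -/j in y0 y2.
    have := ler_wpM2r (ltW t0) nR2; have := ler_wpM2l (ler0n R n) t1.
    by rewrite /fst_coord -/j in y0 y2; move=> h1 h2; apply/andP; split; lra.
  + move=> y i cy ij; rewrite affine_map1 !mxE (negbTE ij) andbF mulr0 addr0.
    exact: cylinder_coord_le1 cy ij.
  + by rewrite Ej; ring.
- move=> Omega M b Lambda u oO bO cO bij Mball L0 uc uconv uMA ubd x Ox.
  (* A kernel vector of [M] would have the same image as 0 under the bijection. *)
  have M0 : \det M != 0.
    apply/negP => /det0P[v v0 vM]; move: v0; rewrite -(subr0 v) subr_eq0 => /eqP; apply.
    apply: (bij_inj bij); rewrite /affine_map vM mul0mx//.
  (* Ensures that the infimum defining the distance is over a nonempty set. *)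
  have bne : boundary Omega !=set0.
    have d0 : delta_mx 0 (Ordinal n0) != 0 :> 'rV[R]_n.
      by apply/eqP => /rowP/(_ (Ordinal n0))/eqP; rewrite !mxE !eqxx oner_eq0.
    by have [t _ bt] := ray_boundary oO bO Ox d0; exists (x + t *: delta_mx 0 (Ordinal n0)).
  have [N [c [j [detN regj regi xj]]]] := adapted_coordinates oO bO n0 M0 Mball cO Ox bne.
  have := est Omega u Lambda N c j _ x oO bO uc uconv L0 uMA ubd _ _ regj regi Ox xj.
  rewrite detN; apply.
    by rewrite -normr_eq0 detN normr_eq0.
  exact: spectral_dist_bounds oO bO n0 M0 Mball _ Ox bne.
Qed.
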